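(* Let $X$ be a path connected and locally path connected topological space. Then $X$ is lasso homotopically Hausdorff if and only if $X$ is shape injective.
   Context: **Normal covers.** An open cover $\mathcal U$ of a space $X$ is normal if it admits a partition of unity $\{\phi_U:X\to[0,1]\}_{U\in\mathcal U}$ (continuous functions with $\sum_U\phi_U=1$; it can be chosen locally finite) with $\phi_U^{-1}(0,1]\subset U$ for each $U\in\mathcal U$. A cover $\mathcal V$ refines $\mathcal U$ if each element of $\mathcal V$ is contained in some element of $\mathcal U$. **Lasso homotopically Hausdorff.** For an open cover $\mathcal U$ of $X$ and $x\in X$, let $\pi_1(\mathcal U,x)$ be the subgroup of $\pi_1(X,x)$ generated by the elements $[\alpha\gamma\alpha^{-1}]$, where $\alpha$ is a path in $X$ starting at $x$ and $\gamma$ is a loop, based at the terminal point of $\alpha$, lying in some $U\in\mathcal U$. A space $X$ is lasso homotopically Hausdorff if for each $x\in X$ and each essential loop $\gamma$ based at $x$ (i.e. $[\gamma]\neq 1$ in $\pi_1(X,x)$) there is a normal open cover $\mathcal U$ of $X$ such that $[\gamma]\notin\pi_1(\mathcal U,x)$. **Shape injective.** For an open cover $\mathcal U$ of $X$, let $R(X,\mathcal U)$ be the simplicial complex whose vertices are the points of $X$ and whose simplices are the nonempty finite sets $A\subset X$ contained in some $U\in\mathcal U$. A $\mathcal U$-chain is a finite list $x_1,\ldots,x_n$ of points of $X$ such that for each $i<n$ both $x_i,x_{i+1}$ lie in a common $U\in\mathcal U$; it is identified with the corresponding edge path in $R(X,\mathcal U)$, and two $\mathcal U$-chains are $\mathcal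 U$-homotopic if the corresponding paths are homotopic rel endpoints in $R(X,\mathcal U)$. If $\mathcal V$ refines $\mathcal U$, the identity on vertices gives a simplicial map $R(X,\mathcal V)\to R(X,\mathcal U)$. The shape group $\check\pi_1(X,x_0)$, classically the inverse limit of the fundamental groups of the nerves of normal open covers, is identified with the group $\varprojlim\pi_1(R(X,\mathcal U),x_0)$, the limit being over all normal open covers $\mathcal U$ of $X$ ordered by refinement. The natural homomorphism $\varphi:\pi_1(X,x_0)\to\check\pi_1(X,x_0)$ is defined as follows: for a loop $\alpha:[0,1]\to X$ at $x_0$ and a normal open cover $\mathcal U$, choose a subdivision $0=t_0<t_1<\cdots<t_k=1$ such that each $\alpha([t_i,t_{i+1}])$ lies in some element of $\mathcal U$; the $\mathcal U$-coordinate of $\varphi([\alpha])$ is the class of the $\mathcal U$-chain $\alpha(t_0),\alpha(t_1),\ldots,\alpha(t_k)$ in $\pi_1(R(X,\mathcal U),x_0)$. This is well defined (independent of choices). $X$ is shape injective if $\varphi$ is injective (for path connected $X$ this does not depend on the basepoint $x_0$). *)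

(* Defs.v *)
From HB Require Import structures.
From mathcomp Require Import all_boot all_order all_algebra generic_quotient.
From mathcomp Require Import all_classical reals ereal topology normedtype esum.
From mathcomp Require Import homotopy.
From mathcomp Require Import lra.

Set Implicit Arguments.
Unset Strict Implicit.
Unset Printing Implicit Defensive.

Import Order.TTheory GRing.Theory Num.Theory.
Import numFieldNormedType.Exports.

Local Open Scope classical_set_scope.
Local Open Scope ring_scope.
Local Open Scope quotient_scope.

Section unit_interval.
Variable R : realType.

Definition unit_interval : Type := `[0%R, 1%R]%classic : set R.

HB.instance Definition _ := Topological.on unit_interval.

Implicit Types s : unit_interval.
Definition ival s : R := set_val s.

Lemma ival_ge0 s : 0 <= ival s.
Proof. by case: s => x xI; move: (set_mem xI); rewrite /= in_itv => /andP[]. Qed.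

Lemma ival_le1 s : ival s <= 1.
Proof. by case: s => x xI; move: (set_mem xI); rewrite /= in_itv => /andP[]. Qed.

Lemma ival_inj : injective ival.
Proof. by move=> [x px] [y py]; exact: eq_exist. Qed.

Lemma clamp_subproof (x : R) :
  Num.max 0 (Num.min 1 x) \in (`[0%R, 1%R]%classic : set R).
Proof.
by apply/mem_set; rewrite /= in_itv /= le_max lexx ge_max ler01 ge_min lexx.
Qed.

(* Nearest-point retraction of [R] onto the unit interval. *)
Definition clamp (x : R) : unit_interval :=
  exist (fun y => y \in (`[0%R, 1%R]%classic : set R)) _ (clamp_subproof x).

Lemma ival_clamp x : ival (clamp x) = Num.max 0 (Num.min 1 x).
Proof. by []. Qed.

Lemma clampK s : clamp (ival s) = s.
Proof.
apply: ival_inj; rewrite ival_clamp.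
have := ival_ge0 s; have := ival_le1 s => s1 s0.
by rewrite (min_idPr s1) (max_idPr s0).
Qed.

Lemma ival_continuous : continuous ival.
Proof. exact: initial_continuous. Qed.

Lemma clamp_continuous : continuous clamp.
Proof.
apply: continuous_comp_initial => x.
apply: (@continuous_max R R (cst 0) (fun x => Num.min 1 x)).
  exact: cst_continuous.
by apply: (@continuous_min R R (cst 1) id) => //; exact: cst_continuous.
Qed.

Lemma clamp01_neq : clamp 0 != clamp 1.
Proof.
apply/eqP => /(congr1 ival).
by rewrite !ival_clamp minxx (max_idPr ler01) (min_idPr ler01) maxxx; lra.
Qed.

HB.instance Definition _ := isBiPointed.Build unit_interval clamp01_neq.

Lemma ival0 : ival zero = 0.
Proof. by rewrite ival_clamp (min_idPr ler01) maxxx. Qed.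

Lemma ival1 : ival one = 1.
Proof. by rewrite ival_clamp minxx (max_idPr ler01). Qed.

End unit_interval.

Section continuity_lemmas.
Context {R : realType}.
Implicit Types (T : topologicalType) (X : topologicalType).

Lemma cst_fun_continuous T X (x : X) : continuous (fun _ : T => x).
Proof. exact: cst_continuous. Qed.

Lemma id_fun_continuous T : continuous (fun z : T => z).
Proof. by move=> z; exact: cvg_id. Qed.

Lemma continuous_comp_fun T1 T2 X (f : T1 -> T2) (g : T2 -> X) :
  continuous f -> continuous g -> continuous (fun z => g (f z)).
Proof. by move=> cf cg z; apply: continuous_comp; [exact: cf|exact: cg]. Qed.

Lemma continuous_pair_fun T X1 X2 (f : T -> X1) (g : T -> X2) :
  continuous f -> continuous g -> continuous (fun z => (f z, g z)).
Proof. by move=> cf cg z; apply: cvg_pair; [exact: cf|exact: cg]. Qed.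

Lemma continuous_fst_fun X1 X2 : continuous (fun z : X1 * X2 => z.1 : X1).
Proof. by move=> z; exact: cvg_fst. Qed.

Lemma continuous_snd_fun X1 X2 : continuous (fun z : X1 * X2 => z.2 : X2).
Proof. by move=> z; exact: cvg_snd. Qed.

Lemma continuousD_fun T (f g : T -> R) :
  continuous f -> continuous g -> continuous (fun z => f z + g z).
Proof. by move=> cf cg z; apply: (@continuousD R R^o); [exact: cf|exact: cg]. Qed.

Lemma continuousN_fun T (f : T -> R) : continuous f -> continuous (fun z => - f z).
Proof. by move=> cf z; apply: (@continuousN R R^o); exact: cf. Qed.

Lemma continuousM_fun T (f g : T -> R) :
  continuous f -> continuous g -> continuous (fun z => f z * g z).
Proof. by move=> cf cg z; apply: continuousM; [exact: cf|exact: cg]. Qed.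

Lemma continuous_min_fun T (f g : T -> R) :
  continuous f -> continuous g -> continuous (fun z => Num.min (f z) (g z)).
Proof. by move=> cf cg z; apply: (@continuous_min R T); [exact: cf|exact: cg]. Qed.

Lemma continuous_ival_fun T (f : T -> unit_interval R) :
  continuous f -> continuous (fun z => ival (f z)).
Proof. by move=> cf; apply: continuous_comp_fun cf (@ival_continuous R). Qed.

Lemma continuous_clamp_fun T (f : T -> R) :
  continuous f -> continuous (fun z => clamp (f z)).
Proof. by move=> cf; apply: continuous_comp_fun cf (@clamp_continuous R). Qed.

Lemma path_continuous_fun T X (x y : X) (p : {path (unit_interval R) from x to y})
    (f : T -> unit_interval R) :
  continuous f -> continuous (fun z => p (f z)).
Proof. by move=> cf; apply: continuous_comp_fun cf _; exact: cts_fun. Qed.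

Lemma continuous_if_le T X (u : T -> R) (c : R) (f g : T -> X) :
  continuous u -> continuous f -> continuous g ->
  (forall z, u z = c -> f z = g z) ->
  continuous (fun z => if u z <= c then f z else g z).
Proof.
move=> cu cf cg fg; pose h z := if u z <= c then f z else g z.
change (continuous h).
have cA : closed [set z | u z <= c].
  by apply: (closed_comp (f := u) (D := [set y | y <= c])) => //; exact: closed_le.
have cB : closed [set z | c <= u z].
  by apply: (closed_comp (f := u) (D := [set y | c <= y])) => //; exact: closed_ge.
have AB : [set z | u z <= c] `|` [set z | c <= u z] = setT.
  by apply/seteqP; split=> z //= _; case: (leP (u z) c) => [|/ltW]; [left|right].
apply/continuous_subspace_setT; rewrite -AB.
apply: withinU_continuous => //.
  apply: (@subspace_eq_continuous _ _ _ f).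
    by move=> z /set_mem /= zc; rewrite /from_subspace /h ifT.
  exact: continuous_subspaceT.
apply: (@subspace_eq_continuous _ _ _ g); last exact: continuous_subspaceT.
move=> z /set_mem /= cz; rewrite /from_subspace /h; case: ifPn => // zc.
by apply/esym/fg/le_anti; rewrite zc cz.
Qed.

End continuity_lemmas.

Ltac cts_step := lazymatch goal with
  | |- continuous (fun _ => clamp _) => apply: continuous_clamp_fun
  | |- continuous (fun _ => (_ + _)%R) => apply: continuousD_fun
  | |- continuous (fun _ => (- _)%R) => apply: continuousN_fun
  | |- continuous (fun _ => (_ * _)%R) => apply: continuousM_fun
  | |- continuous (fun _ => Num.min _ _) => apply: continuous_min_fun
  | |- continuous (fun _ => ival _) => apply: continuous_ival_fun
  | |- continuous (fun z => z) => exact: id_fun_continuous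
  | |- continuous (fun z => z.1) => exact: continuous_fst_fun
  | |- continuous (fun z => z.2) => exact: continuous_snd_fun
  | |- continuous fst => exact: continuous_fst_fun
  | |- continuous snd => exact: continuous_snd_fun
  | |- continuous (fun _ => ?c) => exact: cst_fun_continuous
  | _ => first [assumption | exact: cts_fun | exact: ival_continuous
              | apply: path_continuous_fun]
  end.

Ltac cts := solve [repeat cts_step].

Section homotopy.
Variable R : realType.
Local Notation I := (unit_interval R).
Context {X : topologicalType}.
Implicit Types x y z : X.

(* Homotopy relative to the endpoints. *)
Definition path_homotopic x y (p q : {path I from x to y}) : Prop :=
  exists H : I * I -> X, [/\ continuous H,
    forall s, H (s, zero) = p s,
    forall s, H (s, one) = q s,
    forall t, H (zero, t) = x &
    forall t, H (one, t) = y].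

Lemma path_homotopic_refl x y (p : {path I from x to y}) : path_homotopic p p.
Proof.
exists (fun st => p st.1); split=> //.
- by cts.
- by move=> t; rewrite path_zero.
- by move=> t; rewrite path_one.
Qed.

Lemma path_homotopic_sym x y (p q : {path I from x to y}) :
  path_homotopic p q -> path_homotopic q p.
Proof.
move=> [H [cH H0 H1 Hx Hy]].
exists (fun st => H (st.1, clamp (1 - ival st.2))); split=> //=.
- apply: (continuous_comp_fun (f := fun st : I * I => (st.1, clamp (1 - ival st.2)))) cH.
  by apply: continuous_pair_fun; cts.
- by move=> s; rewrite -H1 ival0 subr0.
- by move=> s; rewrite -H0 ival1 subrr.
Qed.

Lemma clamp_le0 (r : R) : r <= 0 -> clamp r = zero.
Proof.
by move=> r0; apply: ival_inj; rewrite ival0 ival_clamp /Num.max /Num.min;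
  repeat case: ifPn; lra.
Qed.

Lemma clamp_ge1 (r : R) : 1 <= r -> clamp r = one.
Proof.
by move=> r0; apply: ival_inj; rewrite ival1 ival_clamp /Num.max /Num.min;
  repeat case: ifPn; lra.
Qed.

Lemma ival_clampE (r : R) : 0 <= r <= 1 -> ival (clamp r) = r.
Proof.
by move=> /andP[r0 r1]; rewrite ival_clamp /Num.max /Num.min; repeat case: ifPn; lra.
Qed.

Lemma path_homotopic_trans x y (p q r : {path I from x to y}) :
  path_homotopic p q -> path_homotopic q r -> path_homotopic p r.
Proof.
move=> [H [cH H0 H1 Hx Hy]] [K [cK K0 K1 Kx Ky]].
exists (fun st => if ival st.2 <= 2^-1 then H (st.1, clamp (2 * ival st.2))
                  else K (st.1, clamp (2 * ival st.2 - 1))); split=> //=.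
- apply: continuous_if_le.
  + by cts.
  + apply: (continuous_comp_fun
      (f := fun st : I * I => (st.1, clamp (2 * ival st.2)))) cH.
    by apply: continuous_pair_fun; cts.
  + apply: (continuous_comp_fun
      (f := fun st : I * I => (st.1, clamp (2 * ival st.2 - 1)))) cK.
    by apply: continuous_pair_fun; cts.
  + move=> -[s t] /= ->.
    rewrite (clamp_ge1 (r := 2 * _)); last by lra.
    by rewrite (clamp_le0 (r := _ - _)) ?H1 ?K0//; lra.
- by move=> s; rewrite ival0 ifT ?clamp_le0 ?H0//; lra.
- by move=> s; rewrite ival1 ifF ?clamp_ge1 ?K1//; lra.
- by move=> t; case: ifP.
- by move=> t; case: ifP.
Qed.

Definition path_homotopicb x y (p q : {path I from x to y}) : bool :=
  `[< path_homotopic p q >].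

Lemma path_homotopicb_refl x y : reflexive (@path_homotopicb x y).
Proof. by move=> p; apply/asboolP/path_homotopic_refl. Qed.

Lemma path_homotopicb_sym x y : symmetric (@path_homotopicb x y).
Proof.
by move=> p q; apply/idP/idP => /asboolP pq; apply/asboolP/path_homotopic_sym.
Qed.

Lemma path_homotopicb_trans x y : transitive (@path_homotopicb x y).
Proof.
move=> q p r /asboolP pq /asboolP qr; apply/asboolP.
exact: path_homotopic_trans pq qr.
Qed.

Definition path_equiv x y : equiv_rel {path I from x to y} :=
  EquivRel (@path_homotopicb x y) (@path_homotopicb_refl x y)
    (@path_homotopicb_sym x y) (@path_homotopicb_trans x y).

Lemma path_homotopic_reparam x y (p q : {path I from x to y}) (h : I -> X)
    (f g : I -> I) :
  continuous h -> continuous f -> continuous g ->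
  f zero = g zero -> f one = g one ->
  (forall s, p s = h (f s)) -> (forall s, q s = h (g s)) ->
  path_homotopic p q.
Proof.
move=> ch cf cg fg0 fg1 ph qh.
pose F (st : I * I) := (1 - ival st.2) * ival (f st.1) + ival st.2 * ival (g st.1).
have Fe s t : f s = g s -> clamp (F (s, t)) = f s.
  move=> fgs; rewrite /F /= fgs -mulrDl subrK mul1r; exact: clampK.
exists (fun st => h (clamp (F st))); split.
- apply: (continuous_comp_fun (f := fun st => clamp (F st))) ch.
  have cf1 : continuous (fun st : I * I => f st.1).
    by apply: (continuous_comp_fun (f := fst)) cf; cts.
  have cg1 : continuous (fun st : I * I => g st.1).
    by apply: (continuous_comp_fun (f := fst)) cg; cts.
  by rewrite /F; cts.
- by move=> s; rewrite /F /= ival0 subr0 mul1r mul0r addr0 clampK ph.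
- by move=> s; rewrite /F /= ival1 subrr mul1r mul0r add0r clampK qh.
- by move=> t; rewrite Fe// -ph path_zero.
- by move=> t; rewrite Fe// -ph path_one.
Qed.

Section concat.
Variables (x y z : X) (p : {path I from x to y}) (q : {path I from y to z}).

Definition concat_fun (s : I) : X :=
  if ival s <= 2^-1 then p (clamp (2 * ival s)) else q (clamp (2 * ival s - 1)).

Lemma concat_continuous : continuous concat_fun.
Proof.
apply: continuous_if_le; [by cts..|].
move=> s ->; rewrite (clamp_ge1 (r := 2 * _)); last by lra.
by rewrite (clamp_le0 (r := _ - _)) ?path_one ?path_zero//; lra.
Qed.

Lemma concat_zero : concat_fun zero = x.
Proof. by rewrite /concat_fun ival0 ifT ?clamp_le0 ?path_zero//; lra. Qed.

Lemma concat_one : concat_fun one = z.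
Proof. by rewrite /concat_fun ival1 ifF ?clamp_ge1 ?path_one//; lra. Qed.

Definition concat_path : {path I from x to z} :=
  mk_path concat_continuous concat_zero concat_one.

Lemma concat_pathE s : concat_path s =
  if ival s <= 2^-1 then p (clamp (2 * ival s)) else q (clamp (2 * ival s - 1)).
Proof. by []. Qed.

End concat.

Section reverse.
Variables (x y : X) (p : {path I from x to y}).

Definition reverse_fun (s : I) : X := p (clamp (1 - ival s)).

Lemma reverse_continuous : continuous reverse_fun.
Proof. by rewrite /reverse_fun; cts. Qed.

Lemma reverse_zero : reverse_fun zero = y.
Proof. by rewrite /reverse_fun ival0 subr0 path_one. Qed.

Lemma reverse_one : reverse_fun one = x.
Proof. by rewrite /reverse_fun ival1 subrr path_zero. Qed.

Definition reverse_path : {path I from y to x} :=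
  mk_path reverse_continuous reverse_zero reverse_one.

Lemma reverse_pathE s : reverse_path s = p (clamp (1 - ival s)).
Proof. by []. Qed.

End reverse.

Definition constant_path x : {path I from x to x} :=
  [the {path I from x to x} of cst x].

Lemma reverse_pathK x y (p : {path I from x to y}) :
  reverse_path (reverse_path p) = p.
Proof.
apply/path_eqP => s; rewrite !reverse_pathE ival_clampE ?subKr ?clampK//.
by have := ival_ge0 s; have := ival_le1 s; lra.
Qed.

Lemma concat_path_homotopic x y z (p p' : {path I from x to y})
    (q q' : {path I from y to z}) :
  path_homotopic p p' -> path_homotopic q q' ->
  path_homotopic (concat_path p q) (concat_path p' q').
Proof.
move=> [H [cH H0 H1 Hx Hy]] [K [cK K0 K1 Kx Ky]].
exists (fun st => if ival st.1 <= 2^-1 then H (clamp (2 * ival st.1), st.2)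
                  else K (clamp (2 * ival st.1 - 1), st.2)); split=> /=.
- apply: continuous_if_le.
  + by cts.
  + apply: (continuous_comp_fun
      (f := fun st : I * I => (clamp (2 * ival st.1), st.2))) cH.
    by apply: continuous_pair_fun; cts.
  + apply: (continuous_comp_fun
      (f := fun st : I * I => (clamp (2 * ival st.1 - 1), st.2))) cK.
    by apply: continuous_pair_fun; cts.
  + move=> -[s t] /= ->.
    rewrite (clamp_ge1 (r := 2 * _)); last by lra.
    by rewrite (clamp_le0 (r := _ - _)) ?Hy ?Kx//; lra.
- by move=> s; rewrite concat_pathE; case: ifP.
- by move=> s; rewrite concat_pathE; case: ifP.
- by move=> t; rewrite ival0 ifT ?clamp_le0 ?Hx//; lra.
- by move=> t; rewrite ival1 ifF ?clamp_ge1 ?Ky//; lra.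
Qed.

Lemma reverse_path_homotopic x y (p q : {path I from x to y}) :
  path_homotopic p q -> path_homotopic (reverse_path p) (reverse_path q).
Proof.
move=> [H [cH H0 H1 Hx Hy]].
exists (fun st => H (clamp (1 - ival st.1), st.2)); split=> //=.
- apply: (continuous_comp_fun
    (f := fun st : I * I => (clamp (1 - ival st.1), st.2))) cH.
  by apply: continuous_pair_fun; cts.
- by move=> s; rewrite H0.
- by move=> s; rewrite H1.
- by move=> t; rewrite ival0 subr0 Hy.
- by move=> t; rewrite ival1 subrr Hx.
Qed.

Ltac clamp_cases := rewrite ?ival_clamp /Num.max /Num.min; repeat case: ifPn; lra.

Lemma concat_pathA x y z t (p : {path I from x to y}) (q : {path I from y to z})
    (r : {path I from z to t}) :
  path_homotopic (concat_path p (concat_path q r))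
                 (concat_path (concat_path p q) r).
Proof.
apply: (@path_homotopic_reparam _ _ _ _ (concat_path p (concat_path q r)) id
  (fun s => clamp (Num.min (2 * ival s)
     (Num.min (ival s + 4^-1) (2^-1 * ival s + 2^-1))))).
- exact: cts_fun.
- by move=> s; exact: cvg_id.
- by cts.
- by apply: ival_inj; rewrite /= ival_clamp !ival0; clamp_cases.
- by apply: ival_inj; rewrite /= ival_clamp !ival1; clamp_cases.
- by [].
- move=> s; have s0 := ival_ge0 s; have s1 := ival_le1 s.
  case: (leP (ival s) 4^-1) => s4.
    rewrite !(min_idPl _); [|by rewrite ?le_min; lra..].
    rewrite !concat_pathE !(ival_clampE (r := 2 * ival s)); [|lra..].
    by rewrite !ifT//; lra.
  case: (leP (ival s) 2^-1) => s2.
    rewrite (min_idPl (_ : ival s + 4^-1 <= 2^-1 * ival s + 2^-1)); last lra.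
    rewrite (min_idPr (_ : ival s + 4^-1 <= 2 * ival s)); last lra.
    rewrite !concat_pathE (ival_clampE (r := ival s + _)); last lra.
    rewrite ifT// (ival_clampE (r := 2 * ival s)); last lra.
    rewrite (ival_clampE (r := 2 * (ival s + _) - 1)); last lra.
    rewrite ifF; last lra.
    rewrite ifF; last lra.
    rewrite ifT; last lra.
    by congr (q (clamp _)); lra.
  rewrite (min_idPr (_ : 2^-1 * ival s + 2^-1 <= ival s + 4^-1)); last lra.
  rewrite (min_idPr (_ : 2^-1 * ival s + 2^-1 <= 2 * ival s)); last lra.
  rewrite !concat_pathE ifF; last lra.
  rewrite (ival_clampE (r := 2^-1 * _ + _)); last lra.
  rewrite ifF; last lra.
  rewrite ival_clampE; last lra.
  rewrite ifF; last lra.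
  by congr (r (clamp _)); lra.
Qed.

Lemma concat_constantl x y (p : {path I from x to y}) :
  path_homotopic (concat_path (constant_path x) p) p.
Proof.
apply: (@path_homotopic_reparam _ _ _ _ p (fun s => clamp (2 * ival s - 1)) id).
- exact: cts_fun.
- by cts.
- by move=> s; exact: cvg_id.
- by rewrite ival0 clamp_le0//; lra.
- by rewrite ival1 clamp_ge1//; lra.
- move=> s; rewrite concat_pathE; case: ifPn => // s2.
  by rewrite (clamp_le0 (r := _ - _)) ?path_zero//; lra.
- by [].
Qed.

Lemma concat_constantr x y (p : {path I from x to y}) :
  path_homotopic (concat_path p (constant_path y)) p.
Proof.
apply: (@path_homotopic_reparam _ _ _ _ p (fun s => clamp (2 * ival s)) id).
- exact: cts_fun.
- by cts.
- by move=> s; exact: cvg_id.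
- by rewrite ival0 clamp_le0//; lra.
- by rewrite ival1 clamp_ge1//; lra.
- move=> s; rewrite concat_pathE; case: ifPn => // s2.
  by rewrite (clamp_ge1 (r := 2 * ival s)) ?path_one//; lra.
- by [].
Qed.

Lemma concat_reverser x y (p : {path I from x to y}) :
  path_homotopic (concat_path p (reverse_path p)) (constant_path x).
Proof.
apply: (@path_homotopic_reparam _ _ _ _ p
  (fun s => clamp (Num.min (2 * ival s) (2 - 2 * ival s))) (fun=> zero)).
- exact: cts_fun.
- by cts.
- by cts.
- by apply: ival_inj; rewrite /= ival_clamp !ival0; clamp_cases.
- by apply: ival_inj; rewrite /= ival_clamp ival1 ival0; clamp_cases.
- move=> s; have s0 := ival_ge0 s; have s1 := ival_le1 s.
  rewrite concat_pathE; case: ifPn => s2.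
    by rewrite (min_idPl _)//; lra.
  rewrite (min_idPr _); last lra.
  rewrite reverse_pathE ival_clampE; last lra.
  by congr (p (clamp _)); lra.
- by move=> s; rewrite path_zero.
Qed.

Lemma concat_reversel x y (p : {path I from x to y}) :
  path_homotopic (concat_path (reverse_path p) p) (constant_path y).
Proof. by have := concat_reverser (reverse_path p); rewrite reverse_pathK. Qed.

End homotopy.

Section fundamental_group.
Variable R : realType.
Local Notation I := (unit_interval R).
Context {X : topologicalType}.
Implicit Types x : X.

Definition pi1 x : Type := {eq_quot (path_equiv R x x)}.

HB.instance Definition _ x := Choice.on (pi1 x).

Definition loop_class x (p : {path I from x to x}) : pi1 x :=
  \pi_{eq_quot (path_equiv R x x)} p.

Definition loop_repr x (g : pi1 x) : {path I from x to x} :=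
  repr (g : {eq_quot (path_equiv R x x)}).

Lemma loop_reprK x : cancel (@loop_repr x) (@loop_class x).
Proof. by move=> g; exact: reprK. Qed.

Lemma loop_classP x (p q : {path I from x to x}) :
  loop_class p = loop_class q <-> path_homotopic p q.
Proof.
split=> [/eqP|pq]; first by rewrite eqmodE => /asboolP.
by apply/eqP; rewrite eqmodE; apply/asboolP.
Qed.

Lemma loop_repr_class x (p : {path I from x to x}) :
  path_homotopic (loop_repr (loop_class p)) p.
Proof. by apply/loop_classP; rewrite loop_reprK. Qed.

Definition pi1_one x : pi1 x := loop_class (constant_path R x).
Definition pi1_mul x (g h : pi1 x) : pi1 x :=
  loop_class (concat_path (loop_repr g) (loop_repr h)).
Definition pi1_inv x (g : pi1 x) : pi1 x :=
  loop_class (reverse_path (loop_repr g)).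

Lemma pi1_mulE x (p q : {path I from x to x}) :
  pi1_mul (loop_class p) (loop_class q) = loop_class (concat_path p q).
Proof. by apply/loop_classP/concat_path_homotopic; exact: loop_repr_class. Qed.

Lemma pi1_invE x (p : {path I from x to x}) :
  pi1_inv (loop_class p) = loop_class (reverse_path p).
Proof. by apply/loop_classP/reverse_path_homotopic; exact: loop_repr_class. Qed.

Lemma pi1_mulA x : associative (@pi1_mul x).
Proof.
move=> g h k; rewrite -(loop_reprK g) -(loop_reprK h) -(loop_reprK k) !pi1_mulE.
exact/loop_classP/concat_pathA.
Qed.

Lemma pi1_mul1g x : left_id (pi1_one x) (@pi1_mul x).
Proof.
move=> g; rewrite -(loop_reprK g) pi1_mulE.
exact/loop_classP/concat_constantl.
Qed.

Lemma pi1_mulg1 x : right_id (pi1_one x) (@pi1_mul x).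
Proof.
move=> g; rewrite -(loop_reprK g) pi1_mulE.
exact/loop_classP/concat_constantr.
Qed.

Lemma pi1_mulVg x : left_inverse (pi1_one x) (@pi1_inv x) (@pi1_mul x).
Proof.
move=> g; rewrite -(loop_reprK g) pi1_invE pi1_mulE.
exact/loop_classP/concat_reversel.
Qed.

Lemma pi1_mulgV x : right_inverse (pi1_one x) (@pi1_inv x) (@pi1_mul x).
Proof.
move=> g; rewrite -(loop_reprK g) pi1_invE pi1_mulE.
exact/loop_classP/concat_reverser.
Qed.

HB.instance Definition _ x := isGroup.Build (pi1 x)
  (@pi1_mulA x) (@pi1_mul1g x) (@pi1_mulg1 x) (@pi1_mulVg x) (@pi1_mulgV x).

Lemma loop_classM x (p q : {path I from x to x}) :
  loop_class (concat_path p q) = (loop_class p * loop_class q)%g.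
Proof. by rewrite -pi1_mulE. Qed.

Lemma loop_classV x (p : {path I from x to x}) :
  loop_class (reverse_path p) = (loop_class p)^-1%g.
Proof. by rewrite -pi1_invE. Qed.

Lemma loop_class1 x : loop_class (constant_path R x) = 1%g.
Proof. by []. Qed.

End fundamental_group.

Section induced_map.
Variable R : realType.
Local Notation I := (unit_interval R).
Context {X Y : topologicalType}.
Variables (f : X -> Y) (cf : continuous f) (x : X) (y : Y) (fx : f x = y).

Section loops.
Variable p : {path I from x to x}.

Lemma map_loop_continuous : continuous (f \o p).
Proof. by move=> s; apply: continuous_comp; [exact: cts_fun|exact: cf]. Qed.

Lemma map_loop_zero : (f \o p) zero = y.
Proof. by rewrite /= path_zero. Qed.

Lemma map_loop_one : (f \o p) one = y.
Proof. by rewrite /= path_one. Qed.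

Definition map_loop : {path I from y to y} :=
  mk_path map_loop_continuous map_loop_zero map_loop_one.

End loops.

Lemma map_loop_homotopic (p q : {path I from x to x}) :
  path_homotopic p q -> path_homotopic (map_loop p) (map_loop q).
Proof.
move=> [H [cH H0 H1 Hx Hy]]; exists (f \o H); split=> /=.
- by move=> st; apply: continuous_comp; [exact: cH|exact: cf].
- by move=> s; rewrite H0.
- by move=> s; rewrite H1.
- by move=> t; rewrite Hx.
- by move=> t; rewrite Hy.
Qed.

Definition pi1_map (g : pi1 R x) : pi1 R y := loop_class (map_loop (loop_repr g)).

Lemma pi1_mapE (p : {path I from x to x}) :
  pi1_map (loop_class p) = loop_class (map_loop p).
Proof. exact/loop_classP/map_loop_homotopic/loop_repr_class. Qed.

Lemma pi1_mapM : {morph pi1_map : a b / (a * b)%g}.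
Proof.
move=> g h; rewrite -(loop_reprK g) -(loop_reprK h) -loop_classM !pi1_mapE.
rewrite -loop_classM; congr loop_class; apply/path_eqP => s.
rewrite concat_pathE; transitivity (f (concat_path (loop_repr g) (loop_repr h) s)).
  by [].
by rewrite concat_pathE; case: ifP.
Qed.

HB.instance Definition _ := isMultiplicative.Build (pi1 R x) (pi1 R y) pi1_map pi1_mapM.

End induced_map.

Section covers.
Variable R : realType.
Local Notation I := (unit_interval R).
Variable X : topologicalType.
Implicit Types U V : set (set X).

(* Covers are sets of sets, not indexed families. *)
Definition open_cover U := U `<=` open /\ \bigcup_(W in U) W = setT.

(* The family is indexed by the elements of [U]; the values of [phi] at other
   sets are irrelevant. No local finiteness is required, so the sum may have
   infinitely many nonzero terms. *)
Definition partition_of_unity U (phi : set X -> X -> R) :=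
  [/\ forall W, U W -> continuous (phi W),
      forall W x, U W -> 0 <= phi W x <= 1,
      forall W x, U W -> 0 < phi W x -> W x &
      forall x, (\esum_(W in U) (phi W x)%:E = 1)%E].

Record normal_cover := NormalCover {
  cover_sets :> set (set X);
  cover_open : open_cover cover_sets;
  cover_normal : exists phi, partition_of_unity cover_sets phi
}.

Definition refines V U := forall W, V W -> exists2 W', U W' & W `<=` W'.

Definition path_connected (A : set X) := forall x y, A x -> A y ->
  exists p : {path I from x to y}, range p `<=` A.

Definition locally_path_connected := forall (x : X) (N : set X), nbhs x N ->
  exists O : set X, [/\ open O, O x, O `<=` N & path_connected O].

(* The classes of the loops a g a^-1 with g contained in some element of [U]. *)
Definition lasso_classes U (x : X) : set (pi1 R x) :=
  [set c | exists (y : X) (a : {path I from x to y}) (g : {path I from y to y}),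
    (exists2 W, U W & range g `<=` W) /\
    c = loop_class (concat_path (concat_path a g) (reverse_path a))].

Arguments lasso_classes : clear implicits.

Definition lasso_subgroup U (x : X) : set (pi1 R x) :=
  smallest (fun H : set (pi1 R x) => group_closed [in H]) (lasso_classes U x).

Arguments lasso_subgroup : clear implicits.

Definition lasso_homotopically_Hausdorff :=
  forall (x : X) (g : {path I from x to x}), loop_class g <> 1%g ->
  exists U : normal_cover, ~ lasso_subgroup U x (loop_class g).

End covers.

(* Every point of [V] is required to be a vertex. *)
Record simplicial_complex (V : choiceType) := SimplicialComplex {
  simplices : set (set V);
  simplex_neq0 : forall A, simplices A -> A !=set0;
  simplex_finite : forall A, simplices A -> finite_set A;
  simplex_face : forall A B, simplices A -> B !=set0 -> B `<=` A -> simplices B;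
  simplex_vertex : forall v, simplices [set v]
}.

Section rips.
Variable (R : realType) (X : topologicalType) (U : normal_cover R X).

Definition rips_simplices : set (set X) := [set A |
  [/\ finite_set A, A !=set0 & exists2 W, cover_sets U W & A `<=` W]].

Lemma rips_neq0 A : rips_simplices A -> A !=set0. Proof. by case. Qed.

Lemma rips_finite A : rips_simplices A -> finite_set A. Proof. by case. Qed.

Lemma rips_face A B : rips_simplices A -> B !=set0 -> B `<=` A -> rips_simplices B.
Proof.
move=> [fA _ [W UW AW]] B0 BA; split=> //; first exact: sub_finite_set fA.
by exists W => //; exact: subset_trans AW.
Qed.

Lemma rips_vertex x : rips_simplices [set x].
Proof.
split; [exact: finite_set1|by exists x|].
have [_ UT] := cover_open U.
have : [set: X] x by [].
by rewrite -UT => -[W UW Wx]; exists W => // _ ->.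
Qed.

Definition rips : simplicial_complex X :=
  SimplicialComplex rips_neq0 rips_finite rips_face rips_vertex.

End rips.

Section realization.
Variables (R : realType) (V : choiceType).

(* Points of the geometric realization, given by their barycentric
   coordinates. *)
Record realization (K : simplicial_complex V) := Realization {
  bary :> V -> R;
  bary_ge0 : forall v, 0 <= bary v;
  bary_simplex : simplices K [set v | bary v != 0];
  bary_sum : \sum_(v \in [set: V]) bary v = 1
}.

Variable K : simplicial_complex V.
Local Notation RK := (realization K).

Lemma bary_inj : injective (@bary K).
Proof.
move=> [f f0 fK f1] [g g0 gK g1] /= fg; case: _ / fg in g0 gK g1 *.
by congr Realization; exact: Prop_irrelevance.
Qed.

HB.instance Definition _ := gen_eqMixin RK.
HB.instance Definition _ := gen_choiceMixin RK.

Definition closed_simplex (A : set V) : set RK :=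
  [set b | [set v | b v != 0] `<=` A].

(* Weak (coherent) topology: a set is open when its trace on each closed simplex
   is open for the Euclidean topology, here the topology of pointwise
   convergence of the (finitely many) barycentric coordinates. *)
Definition weak_open (O : set RK) := forall A, simplices K A ->
  exists2 W : set {ptws V -> R}, open W &
    O `&` closed_simplex A = (fun b : RK => W b) `&` closed_simplex A.

Lemma weak_openT : weak_open setT.
Proof. by move=> A _; exists setT; [exact: openT|]. Qed.

Lemma weak_openI : setI_closed weak_open.
Proof.
move=> O1 O2 oO1 oO2 A KA.
have [W1 oW1 E1] := oO1 A KA; have [W2 oW2 E2] := oO2 A KA.
exists (W1 `&` W2); first exact: openI.
rewrite setIIl E1 E2 -setIIl; apply/seteqP; split=> b /=; tauto.
Qed.

Lemma weak_open_bigU (J : Type) (O : J -> set RK) :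
  (forall j, weak_open (O j)) -> weak_open (\bigcup_j O j).
Proof.
move=> oO A KA.
pose P j (W : set {ptws V -> R}) :=
  open W /\ O j `&` closed_simplex A = (fun b : RK => W b) `&` closed_simplex A.
have /choice[W PW] : forall j, exists W, P j W.
  by move=> j; have [W oW E] := oO j A KA; exists W.
exists (\bigcup_j W j); first by apply: bigcup_open => j _; exact: (PW j).1.
apply/seteqP; split=> b [[j _ jb] bA]; split=> //; exists j => //.
  have : (O j `&` closed_simplex A) b by [].
  by rewrite (PW j).2 => -[].
have : ((fun b : RK => W j b) `&` closed_simplex A) b by [].
by rewrite -(PW j).2 => -[].
Qed.

HB.instance Definition _ :=
  isOpenTopological.Build RK weak_openT weak_openI weak_open_bigU.

Lemma weak_openE (O : set RK) : open O = weak_open O.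
Proof. by []. Qed.

Lemma realization_continuous (T : topologicalType) (A : set V) (f : T -> RK) :
  simplices K A -> (forall s, closed_simplex A (f s)) ->
  (forall v, continuous (fun s => f s v)) -> continuous f.
Proof.
move=> KA fA cf; apply/continuousP => O; rewrite weak_openE => oO.
have [W oW E] := oO A KA.
pose g : T -> {ptws V -> R} := fun s => f s.
have -> : f @^-1` O = g @^-1` W.
  apply/seteqP; split=> s /= h.
    have : (O `&` closed_simplex A) (f s) by split.
    by rewrite E => -[].
  have : ((fun b : RK => W b) `&` closed_simplex A) (f s) by split.
  by rewrite -E => -[].
have cg : continuous g.
  move=> s; apply/cvg_sup => v; apply/cvg_image.
    by apply/seteqP; split=> r // _; exists (cst r).
  move=> B /= Bs; exists ((fun h : V -> R => h v) @^-1` B); first exact: cf.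
  by apply/seteqP; split=> [_ [h hB <-]//|r Br]; exists (cst r).
by move/continuousP: cg; apply.
Qed.

End realization.

Section edge_paths.
Variables (R : realType) (V : choiceType) (K : simplicial_complex V).
Local Notation I := (unit_interval R).
Local Notation RK := (realization R K).

Section vertex.
Variable v : V.

Definition vertex_fun (u : V) : R := (u == v)%:R.

Lemma vertex_ge0 u : 0 <= vertex_fun u. Proof. exact: ler0n. Qed.

Lemma vertex_simplex : simplices K [set u | vertex_fun u != 0].
Proof.
rewrite [X in simplices _ X](_ : _ = [set v]); first exact: simplex_vertex.
apply/seteqP; split=> u /=; rewrite /vertex_fun.
  by case: (u =P v) => // _; rewrite eqxx.
by move=> ->; rewrite eqxx oner_eq0.
Qed.

Lemma vertex_sum : \sum_(u \in [set: V]) vertex_fun u = 1.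
Proof.
rewrite -(fsbig_widen [set v]) ?fsbig_set1 /vertex_fun ?eqxx//.
by move=> u [_ /=]; case: eqP.
Qed.

Definition vertex : RK := Realization vertex_ge0 vertex_simplex vertex_sum.

End vertex.

Section segment.
Variables (A : set V) (KA : simplices K A) (b c : RK).
Hypotheses (bA : closed_simplex A b) (cA : closed_simplex A c).

Lemma closed_simplex_sum (d : RK) : closed_simplex A d -> \sum_(u \in A) d u = 1.
Proof.
move=> dA; rewrite -(bary_sum d); apply: fsbig_widen => // u [_ /= uA].
by apply: contra_notP uA => /eqP; exact: dA.
Qed.

Variable t : I.

Definition segment_bary (u : V) : R := (1 - ival t) * b u + ival t * c u.

Lemma segment_ge0 u : 0 <= segment_bary u.
Proof.
by rewrite addr_ge0// mulr_ge0 ?bary_ge0 ?subr_ge0 ?ival_ge0 ?ival_le1.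
Qed.

Lemma segment_supp : [set u | segment_bary u != 0] `<=` A.
Proof.
move=> u /= u0; apply: contrapT => uA.
have z (d : RK) : closed_simplex A d -> d u = 0.
  by move=> dA; apply: contra_notP uA => /eqP; exact: dA.
by move/eqP: u0; apply; rewrite /segment_bary !z// !mulr0 addr0.
Qed.

Lemma segment_sumA : \sum_(u \in A) segment_bary u = 1.
Proof.
have fA := simplex_finite KA.
rewrite fsbig_split//= -!mulr_fsumr.
by rewrite !closed_simplex_sum// !mulr1 subrK.
Qed.

Lemma segment_sum : \sum_(u \in [set: V]) segment_bary u = 1.
Proof.
rewrite -segment_sumA; apply/esym/fsbig_widen => // u [_ /= uA].
by apply: contra_notP uA => /eqP; exact: segment_supp.
Qed.

Lemma segment_simplex : simplices K [set u | segment_bary u != 0].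
Proof.
apply: simplex_face KA _ segment_supp; apply/set0P/eqP => s0.
have : \sum_(u \in A) segment_bary u = 0.
  apply: fsbig1 => u _; apply: contrapT => /eqP u0.
  by have : [set u | segment_bary u != 0] u by []; rewrite s0.
by rewrite segment_sumA => /eqP; rewrite oner_eq0.
Qed.

Definition segment_fun : RK :=
  Realization segment_ge0 segment_simplex segment_sum.

End segment.

Section segment_path.
Variables (A : set V) (KA : simplices K A) (b c : RK).
Hypotheses (bA : closed_simplex A b) (cA : closed_simplex A c).

Lemma segment_continuous : continuous (segment_fun KA bA cA).
Proof.
apply: (realization_continuous KA); first exact: segment_supp.
by move=> v; rewrite /= /segment_bary; cts.
Qed.

Lemma segment_zero : segment_fun KA bA cA zero = b.
Proof.
by apply/bary_inj/funext => u; rewrite /= /segment_bary ival0; lra.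
Qed.

Lemma segment_one : segment_fun KA bA cA one = c.
Proof.
by apply/bary_inj/funext => u; rewrite /= /segment_bary ival1; lra.
Qed.

Definition segment : {path I from b to c} :=
  mk_path segment_continuous segment_zero segment_one.

End segment_path.

Definition adjacent (v w : V) : bool := `[< simplices K [set v; w] >].

Lemma vertex_suppl v w : closed_simplex [set v; w] (vertex v).
Proof.
by move=> u /=; rewrite /vertex_fun; case: (u =P v) => [->|_]; [left|rewrite eqxx].
Qed.

Lemma vertex_suppr v w : closed_simplex [set v; w] (vertex w).
Proof.
by move=> u /=; rewrite /vertex_fun; case: (u =P w) => [->|_]; [right|rewrite eqxx].
Qed.

(* The straight edge from [v] to [w], constant when [v = w]. *)
Definition edge v w (vw : adjacent v w) : {path I from vertex v to vertex w} :=
  segment (asboolW vw) (@vertex_suppl v w) (@vertex_suppr v w).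

(* The edge path through the vertices [v :: s]. *)
Fixpoint edge_path (v : V) (s : seq V) :
    path.path adjacent v s -> {path I from vertex v to vertex (last v s)} :=
  match s with
  | [::] => fun=> constant_path R (vertex v)
  | w :: s' => fun vws => let h := andP vws in
      concat_path (edge (proj1 h)) (edge_path (proj2 h))
  end.

End edge_paths.

Section chains.
Variables (R : realType) (X : topologicalType).
Local Notation I := (unit_interval R).
Local Notation K := (@rips R X).

Definition cast_path (T : topologicalType) (x x' y y' : T) (ex : x = x')
    (ey : y = y') (p : {path I from x to y}) : {path I from x' to y'} :=
  mk_path (@cts_fun _ _ p) (etrans (path_zero (s := p)) ex) (etrans (path_one (s := p)) ey).

Definition close (U : normal_cover R X) (x y : X) : bool :=
  `[< exists2 W, cover_sets U W & W x /\ W y >].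

Lemma close_adjacent U x y : close U x y -> adjacent (K U) x y.
Proof.
move=> /asboolP[W UW [Wx Wy]]; apply/asboolP; split.
- by rewrite finite_setU; split; exact: finite_set1.
- by exists x; left.
- by exists W => // _ [->|->].
Qed.

(* [x :: s] is a [U]-chain. *)
Definition chain U (x : X) (s : seq X) : bool := path.path (close U) x s.

Lemma chain_adjacent U x s : chain U x s -> path.path (adjacent (K U)) x s.
Proof. by apply: sub_path; exact: close_adjacent. Qed.

Definition chain_path U x s (c : chain U x s) :
    {path I from vertex R (K U) x to vertex R (K U) (last x s)} :=
  edge_path R (chain_adjacent c).

Definition subdivision_step (U : normal_cover R X) (a : I -> X) (s t : I) : bool :=
  `[< ival s < ival t /\ exists2 W, cover_sets U W &
      forall r, ival s <= ival r <= ival t -> W (a r) >].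

(* [zero :: ts] is a subdivision 0 = t_0 < ... < t_k = 1 of the unit interval
   such that [a] maps each [t_i, t_(i+1)] into some element of [U] *)
Definition subdivision (U : normal_cover R X) (a : I -> X) (ts : seq I) : bool :=
  path.path (subdivision_step U a) zero ts && (last zero ts == one).

Lemma subdivision_chain U a ts : subdivision U a ts ->
  chain U (a zero) (map a ts).
Proof.
move=> /andP[+ _]; rewrite /chain path_map; apply: sub_path => s t.
move=> /asboolP[st [W UW aW]]; apply/asboolP; exists W => //.
by split; apply: aW; rewrite lexx (ltW st).
Qed.

Lemma subdivision_last U a ts : subdivision U a ts ->
  last (a zero) (map a ts) = a one.
Proof. by move=> /andP[_ /eqP e]; rewrite last_map e. Qed.

Definition subdivision_loop (x : X) U (a : {path I from x to x}) (ts : seq I)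
    (h : subdivision U a ts) :
    {path I from vertex R (K U) x to vertex R (K U) x} :=
  cast_path
    (congr1 (vertex R (K U)) (path_zero (s := a)))
    (congr1 (vertex R (K U)) (etrans (subdivision_last h) (path_one (s := a))))
    (chain_path (subdivision_chain h)).

End chains.

Section shape_group.
Variables (R : realType) (X : topologicalType).
Local Notation I := (unit_interval R).
Local Notation K := (@rips R X).

Section refinement_map.
Variables (V U : normal_cover R X) (VU : refines V U).

Lemma rips_refines A : simplices (K V) A -> simplices (K U) A.
Proof.
move=> [fA A0 [W VW AW]]; split=> //.
by have [W' UW' WW'] := VU VW; exists W' => //; exact: subset_trans WW'.
Qed.

Definition refinement_map (b : realization R (K V)) : realization R (K U) :=
  Realization (bary_ge0 b) (rips_refines (bary_simplex b)) (bary_sum b).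

Lemma refinement_map_continuous : continuous refinement_map.
Proof.
apply/continuousP => O; rewrite !weak_openE => oO A KA.
have [W oW E] := oO A (rips_refines KA); exists W => //.
apply/seteqP; split=> b [h bA]; split=> //.
  have : (O `&` closed_simplex A) (refinement_map b) by [].
  by rewrite E => -[].
have : ((fun b : realization R (K U) => W b) `&` closed_simplex A)
  (refinement_map b) by [].
by rewrite -E => -[].
Qed.

Lemma refinement_map_vertex x :
  refinement_map (vertex R (K V) x) = vertex R (K U) x.
Proof. exact/bary_inj. Qed.

Definition pi1_refinement x :
    pi1 R (vertex R (K V) x) -> pi1 R (vertex R (K U) x) :=
  pi1_map refinement_map_continuous (refinement_map_vertex x).

Lemma pi1_refinementM x : {morph @pi1_refinement x : a b / (a * b)%g}.
Proof. exact: pi1_mapM. Qed.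

End refinement_map.

Variable x : X.

(* The inverse limit, as the group of coherent families; any two normal covers
   are compared by refinement, as a preorder. *)
Record shape_group := ShapeGroup {
  shape_coord : forall U : normal_cover R X, pi1 R (vertex R (K U) x);
  shape_coherent : forall (V U : normal_cover R X) (VU : refines V U),
    pi1_refinement VU (shape_coord V) = shape_coord U
}.

HB.instance Definition _ := gen_eqMixin shape_group.
HB.instance Definition _ := gen_choiceMixin shape_group.

Lemma shape_coord_inj (g h : shape_group) :
  (forall U, shape_coord g U = shape_coord h U) -> g = h.
Proof.
case: g h => [g gc] [h hc] /= gh.
have {}gh : g = h by exact: functional_extensionality_dep.
by case: _ / gh in hc *; congr ShapeGroup; exact: Prop_irrelevance.
Qed.

Lemma pi1_refinement1 (V U : normal_cover R X) (VU : refines V U) : pi1_refinement VU (x := x) 1%g = 1%g.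
Proof.
by apply: (@mulgI _ (pi1_refinement VU 1%g)); rewrite -pi1_refinementM !mulg1.
Qed.

Lemma pi1_refinementV (V U : normal_cover R X) (VU : refines V U) g :
  pi1_refinement VU (x := x) g^-1%g = (pi1_refinement VU g)^-1%g.
Proof.
apply: (@mulgI _ (pi1_refinement VU g)).
by rewrite -pi1_refinementM !mulgV pi1_refinement1.
Qed.

Definition shape_one : shape_group :=
  @ShapeGroup (fun U => 1%g) (fun V U VU => pi1_refinement1 VU).

Lemma shape_mul_subproof (g h : shape_group) (V U : normal_cover R X) (VU : refines V U) :
  pi1_refinement VU (shape_coord g V * shape_coord h V)%g =
  (shape_coord g U * shape_coord h U)%g.
Proof. by rewrite pi1_refinementM !shape_coherent. Qed.

Definition shape_mul (g h : shape_group) : shape_group :=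
  ShapeGroup (shape_mul_subproof g h).

Lemma shape_inv_subproof (g : shape_group) (V U : normal_cover R X) (VU : refines V U) :
  pi1_refinement VU (shape_coord g V)^-1%g = (shape_coord g U)^-1%g.
Proof. by rewrite pi1_refinementV shape_coherent. Qed.

Definition shape_inv (g : shape_group) : shape_group :=
  ShapeGroup (shape_inv_subproof g).

Lemma shape_mulA : associative shape_mul.
Proof. by move=> g h k; apply: shape_coord_inj => U /=; rewrite mulgA. Qed.

Lemma shape_mul1g : left_id shape_one shape_mul.
Proof. by move=> g; apply: shape_coord_inj => U /=; rewrite mul1g. Qed.

Lemma shape_mulg1 : right_id shape_one shape_mul.
Proof. by move=> g; apply: shape_coord_inj => U /=; rewrite mulg1. Qed.

Lemma shape_mulVg : left_inverse shape_one shape_inv shape_mul.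
Proof. by move=> g; apply: shape_coord_inj => U /=; rewrite mulVg. Qed.

Lemma shape_mulgV : right_inverse shape_one shape_inv shape_mul.
Proof. by move=> g; apply: shape_coord_inj => U /=; rewrite mulgV. Qed.

HB.instance Definition _ := isGroup.Build shape_group
  shape_mulA shape_mul1g shape_mulg1 shape_mulVg shape_mulgV.

(* Every loop has a subdivision subordinate to a given open cover (Lebesgue), so
   this condition determines [phi]. *)
Definition natural_to_shape (phi : pi1 R x -> shape_group) : Prop :=
  forall (U : normal_cover R X) (a : {path I from x to x}) (ts : seq I)
    (h : subdivision U a ts),
  shape_coord (phi (loop_class a)) U = loop_class (subdivision_loop h).

(* The natural homomorphism exists and is injective. Its existence is the
   independence of the class of a chain from the subdivision and from the loop
   in its homotopy class. *)
Definition shape_injective : Prop :=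
  exists phi : {multiplicative pi1 R x -> shape_group},
    natural_to_shape phi /\ injective phi.

End shape_group.

(* Main.v *)
From HB Require Import structures.
From mathcomp Require Import all_boot all_order all_algebra.
From mathcomp Require Import all_classical reals ereal topology normedtype esum.
From mathcomp Require Import finmap homotopy lra.
Require Import Defs.

(** A family [c j x y] of elements of a semigroup that is multiplicative on the
    members [O j] of an open cover can be multiplied along a subdivision of a
    path; the product, the holonomy of the path, depends only on its homotopy
    class.

    The classes of the edges of |R(X, U)| form such a family on [X]. Its holonomy
    is the [U]-coordinate of the natural map, and it kills the lassos of [U]:
    thus a shape injective space is lasso homotopically Hausdorff.

    Conversely, as [X] is locally path connected, a normal cover [U] has a normal
    refinement [V] with path connected elements, such that two meeting elements
    of [V] lie in a common element of [U]: take the path components of the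
    elements of a barycentric refinement. Paths inside elements of [V] then
    define a cocycle with values in the cosets of the lasso subgroup of [U]. It
    extends to |R(X, V)| with its cover by open stars, so a loop of [X] whose
    [V]-coordinate is trivial has trivial holonomy, that is, it belongs to the
    lasso subgroup of [U]. *)

Set Implicit Arguments.
Unset Strict Implicit.
Unset Printing Implicit Defensive.

Import Order.TTheory GRing.Theory Num.Theory.
Import numFieldNormedType.Exports.

Local Open Scope classical_set_scope.
Local Open Scope ring_scope.

(** * Holonomy of a local cocycle *)

Section interval_chain.
Context {R : realType}.

Definition chain_rel (Q : R -> R -> Prop) (a b s t : R) : bool :=
  `[< [/\ a <= s, s < t, t <= b & Q s t] >].

(** A Lebesgue number argument by suprema: the points reachable from [a] have a supremum, near which
    [Q] holds for all short steps, so the chain can always be prolonged until it meets [b]. *)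
Lemma interval_chain (Q : R -> R -> Prop) (a b : R) : a <= b ->
  (forall c, exists2 e, 0 < e &
    forall s t, c - e < s -> s < t -> t < c + e -> Q s t) ->
  exists2 ts, path.path (chain_rel Q a b) a ts & last a ts = b.
Proof.
move=> ab hQ; pose A : set R := [set t | a <= t <= b /\
  exists2 ts, path.path (chain_rel Q a b) a ts & last a ts = t].
have Aa : A a by split; [rewrite lexx ab|exists [::]].
have supA : has_sup A by split; [exists a|exists b => t [/andP[]]].
have [e e0 Qe] := hQ (sup A).
have [t At te] := sup_adherent e0 supA.
have tc : t <= sup A by apply: sup_upper_bound.
have [/andP[at_ tb] [ts ats tst]] := At.
have [bt|tb'] := leP b t.
  by exists ts => //; apply: le_anti; rewrite tst tb bt.
(* One step leads from [t] to [u], so [u] is reachable and cannot exceed [sup A]; hence the minimum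
   is [b]. *)
pose u := Num.min (sup A + e / 2) b.
have tu : t < u by rewrite lt_min tb' andbT; lra.
have uc : u < sup A + e by rewrite gt_min; apply/orP; left; lra.
have Qtu : chain_rel Q a b t u.
  by apply/asboolP; split; rewrite ?ge_min ?lexx ?orbT//; apply: Qe.
have pu : path.path (chain_rel Q a b) a (rcons ts u).
  by rewrite rcons_path ats tst.
have Au : A u.
  split; first by rewrite (le_trans at_ (ltW tu)) ge_min lexx orbT.
  by exists (rcons ts u); rewrite ?last_rcons.
have uA : u <= sup A by apply: sup_upper_bound.
exists (rcons ts u) => //; rewrite last_rcons; apply/min_idPr.
move: uA; rewrite /u ge_min => /orP[|bA]; lra.
Qed.

Lemma interval_induction (Q : R -> R -> Prop) (P : R -> Prop) (a b : R) :
  a <= b ->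
  (forall c, exists2 e, 0 < e &
    forall s t, c - e < s -> s < t -> t < c + e -> Q s t) ->
  P b -> (forall s t, s < t -> Q s t -> P t -> P s) -> P a.
Proof.
move=> ab hQ Pb PQ; have [ts + tsb] := interval_chain ab hQ.
(* The lower bound inside [chain_rel] is detached from the starting point, which moves during the
   induction. *)
move: {1}a => a'; elim: ts a tsb {ab} => [|u ts IH] a /= tsb.
  by rewrite tsb.
by case/andP=> /asboolP[_ au _ Qau] /(IH _ tsb); exact: PQ.
Qed.

End interval_chain.

Section holonomy.
Context {R : realType} {X : topologicalType} {S J : Type}.
Variables (op : S -> S -> S) (O : J -> set X) (c : J -> X -> X -> S).

(* [op] is only a semigroup law: the identities [c j x x] act as local units. *)
Record cocycle : Prop := Cocycle {
  cocycle_opA : associative op;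
  cocycle_open : forall j, open (O j);
  cocycle_cover : forall x, exists j, O j x;
  cocycleM : forall j x y z, O j x -> O j y -> O j z ->
    op (c j x y) (c j y z) = c j x z;
  cocycle_indep : forall j k x y, O j x -> O j y -> O k x -> O k y ->
    c j x y = c k x y
}.

(** A relation instead of a function: the subdivision is part of the derivation, and independence of
    it is [hol_uniq]. The base case is one step, not an empty product, since [S] has no unit. *)
Inductive hol (f : R -> X) : R -> R -> S -> Prop :=
| hol_step j s t : s <= t -> (forall r, s <= r <= t -> O j (f r)) ->
    hol f s t (c j (f s) (f t))
| hol_cons j s t u g : s <= t -> (forall r, s <= r <= t -> O j (f r)) ->
    hol f t u g -> hol f s u (op (c j (f s) (f t)) g).

Lemma hol_le f s t g : hol f s t g -> s <= t.
Proof. by elim=> // j s' t' u _ st _ _; exact: le_trans. Qed.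

Lemma hol_ext f f' s t g : (forall r, s <= r <= t -> f r = f' r) ->
  hol f s t g -> hol f' s t g.
Proof.
move=> + h; elim: h => {s t g} [j s t st Oj|j s t u g st Oj h IH] ff'.
  rewrite !ff' ?lexx ?st//; apply: hol_step => // r /[dup] sr /Oj.
  by rewrite ff'.
have tu := hol_le h.
rewrite !ff' ?lexx ?st ?(le_trans st tu)//; apply: hol_cons => //.
  move=> r /andP[sr rt]; rewrite -ff' ?sr ?(le_trans rt tu)//.
  by apply: Oj; rewrite sr.
by apply: IH => r /andP[tr ru]; rewrite ff'// ru (le_trans st tr).
Qed.

Lemma hol_affine f a b s t g : 0 < a ->
  hol f (a * s + b) (a * t + b) g -> hol (fun r => f (a * r + b)) s t g.
Proof.
move=> a0; set s' := _ + b; set t' := _ + b => h.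
(* Induction on the derivation needs free endpoints, so the inverse affine map is applied to them
   instead. *)
suff : hol (fun r => f (a * r + b)) ((s' - b) / a) ((t' - b) / a) g.
  by rewrite /s' /t' !addrK ![a * _]mulrC !mulfK// gt_eqF.
move: s' t' h => {}s {}t h.
have K x : a * ((x - b) / a) + b = x by rewrite mulrC divfK ?subrK// gt_eqF.
have L x y : x <= y -> (x - b) / a <= (y - b) / a.
  by move=> xy; rewrite ler_pM2r ?invr_gt0// lerD2r.
have M x y r : (x - b) / a <= r <= (y - b) / a -> x <= a * r + b <= y.
  rewrite ler_pdivrMr// ler_pdivlMr// [r * a]mulrC; lra.
elim: h => {s t g} [j s t st Oj|j s t u g st Oj _ IH].
  rewrite -{2}(K s) -{2}(K t).
  by apply: (hol_step (f := fun r => f (a * r + b)) (L _ _ st)) => r /M/Oj.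
rewrite -{2}(K s) -{1}(K t).
by apply: (hol_cons (f := fun r => f (a * r + b)) (L _ _ st)) => // r /M/Oj.
Qed.

Lemma local_step (f : R -> X) : (forall j, open (O j)) ->
  (forall x, exists j, O j x) -> continuous f ->
  forall x, exists2 e, 0 < e & forall s t, x - e < s -> s < t -> t < x + e ->
    exists j, forall r, s <= r <= t -> O j (f r).
Proof.
move=> oO cO cf x; have [j jx] := cO (f x).
have : nbhs (f x) (O j) by exact: open_nbhs_nbhs.
move=> /cf /nbhs_ballP[e /= e0 he]; exists e => // s t xs st tx.
exists j => r /andP[sr rt]; apply: he; rewrite /ball /= ltr_norml; lra.
Qed.

Hypothesis hc : cocycle.

Lemma hol_local f j s t g : (forall r, s <= r <= t -> O j (f r)) ->
  hol f s t g -> g = c j (f s) (f t).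
Proof.
move=> + h; elim: h => {s t g} [k s t st Ok|k s t u g st Ok h IH] Oj.
  by apply: (cocycle_indep hc); do [apply: Ok|apply: Oj]; rewrite lexx st.
have tu := hol_le h; have su := le_trans st tu; rewrite IH.
  have Oks : O k (f s) by apply: Ok; rewrite lexx.
  have Okt : O k (f t) by apply: Ok; rewrite lexx st.
  have Ojs : O j (f s) by apply: Oj; rewrite lexx.
  have Ojt : O j (f t) by apply: Oj; rewrite st tu.
  have Oju : O j (f u) by apply: Oj; rewrite su lexx.
  by rewrite (cocycle_indep hc Oks Okt Ojs Ojt) (cocycleM hc).
by move=> r /andP[tr ru]; apply: Oj; rewrite ru (le_trans st tr).
Qed.

(** The step containing [t] is cut in two by the cocycle identity; the other steps stay as they
    are. *)
Lemma hol_split f s u g t : hol f s u g -> s <= t <= u ->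
  exists g1 g2, [/\ hol f s t g1, hol f t u g2 & g = op g1 g2].
Proof.
move=> h; elim: h => {s u g} [j s u su Oj|j s v u g sv Oj h IH] /andP[st tu].
  exists (c j (f s) (f t)), (c j (f t) (f u)); split.
  - by apply: hol_step => // r /andP[sr rt]; apply: Oj; rewrite sr (le_trans rt).
  - by apply: hol_step => // r /andP[sr rt]; apply: Oj; rewrite rt (le_trans st).
  - by rewrite (cocycleM hc)//; apply: Oj; rewrite ?lexx ?st ?su ?tu.
have [tv|vt] := leP t v.
  exists (c j (f s) (f t)), (op (c j (f t) (f v)) g); split.
  - by apply: hol_step => // r /andP[sr rt]; apply: Oj; rewrite sr (le_trans rt).
  - by apply: hol_cons => // r /andP[sr rt]; apply: Oj; rewrite rt (le_trans st).
  - by rewrite (cocycle_opA hc) (cocycleM hc)//; apply: Oj;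
      rewrite ?lexx ?st ?sv ?tv.
have [|g1 [g2 [h1 h2 ->]]] := IH; first by rewrite (ltW vt).
exists (op (c j (f s) (f v)) g1), g2; split=> //; first exact: hol_cons.
by rewrite (cocycle_opA hc).
Qed.

(** The second derivation is cut at the subdivision points of the first; each piece then lies in one
    [O j], where [hol_local] computes it. *)
Lemma hol_uniq f s t g g' : hol f s t g -> hol f s t g' -> g = g'.
Proof.
move=> h; elim: h g' => {s t g} [j s t st Oj|j s t u g st Oj h IH] g' h'.
  exact/esym/(hol_local Oj).
have [|g1 [g2 [h1 h2 ->]]] := hol_split h' (t := t).
  by rewrite st (hol_le h).
by rewrite (hol_local Oj h1) (IH _ h2).
Qed.

Lemma hol_cat f s t u g h : hol f s t g -> hol f t u h -> hol f s u (op g h).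
Proof.
elim=> {s t g} [j s t st Oj|j s t v g st Oj h' IH] hh; first exact: hol_cons.
by rewrite -(cocycle_opA hc); apply: hol_cons (IH hh).
Qed.

Lemma hol_idl f s t g j : O j (f s) -> hol f s t g ->
  op (c j (f s) (f s)) g = g.
Proof.
move=> js h; case: h js => {s t g} [k s t st Ok|k s t u g st Ok h] js.
all: have Oks : O k (f s) by apply: Ok; rewrite lexx.
all: have Okt : O k (f t) by apply: Ok; rewrite st lexx.
all: rewrite ?(cocycle_opA hc) (cocycle_indep hc js js Oks Oks).
all: by rewrite (cocycleM hc).
Qed.

Lemma hol_idr f s t g j : O j (f t) -> hol f s t g ->
  op g (c j (f t) (f t)) = g.
Proof.
move=> + h; elim: h => {s t g} [k s t st Ok|k s t u g st Ok h IH] js.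
  have Oks : O k (f s) by apply: Ok; rewrite lexx.
  have Okt : O k (f t) by apply: Ok; rewrite st lexx.
  by rewrite (cocycle_indep hc js js Okt Okt) (cocycleM hc).
by rewrite -(cocycle_opA hc) IH.
Qed.

Lemma hol_exists (f : R -> X) s t : continuous f -> s <= t ->
  exists g, hol f s t g.
Proof.
move=> cf st; apply: (interval_induction (P := fun r => exists g, hol f r t g) st
  (local_step (cocycle_open hc) (cocycle_cover hc) cf)).
  have [j jx] := cocycle_cover hc (f t); exists (c j (f t) (f t)).
  by apply: hol_step => // r rs; rewrite (_ : r = t)//; apply/le_anti/andP; lra.
move=> r u ru [j Oj] [g hg]; exists (op (c j (f r) (f u)) g).
by apply: hol_cons => //; exact: ltW.
Qed.

Section homotopy.
Variable H : R * R -> X.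
Hypothesis cH : continuous H.

(** Tube lemma, by compactness of the segment. *)
Lemma tube (P : set X) t0 s u : open P ->
  (forall r, s <= r <= u -> P (H (r, t0))) ->
  \forall t \near t0, forall r, s <= r <= u -> P (H (r, t)).
Proof.
move=> oP hP.
have /compact_near_coveringP cvr := @segment_compact R s u.
have h : \forall t \near t0, `[s, u] `<=` [set r | P (H (r, t))].
  apply: (cvr R (nbhs t0) (fun t r => P (H (r, t)))) => r.
  rewrite /= in_itv /= => rsu.
  have : nbhs (H (r, t0)) P by apply: open_nbhs_nbhs; split=> //; exact: hP.
  move=> /cH [[A B] /= [Ar Bt] AB].
  by exists (A, B) => //= -[r' t'] /= [Ar' Bt']; exact: AB.
by apply: filterS h => t h r rsu; apply: h; rewrite /= in_itv.
Qed.

(** The subdivision at time [t0] still serves at nearby times, and the vertical terms between the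
    two paths cancel as in a ladder. The index is arbitrary at the left end and existential at the
    right end, so that the induction can glue at the common point. *)
Lemma hol_near t0 s u g : hol (fun r => H (r, t0)) s u g ->
  exists2 k, O k (H (u, t0)) & forall j, O j (H (s, t0)) ->
  \forall t \near t0, exists2 g', hol (fun r => H (r, t)) s u g' &
    op (c j (H (s, t0)) (H (s, t))) g' = op g (c k (H (u, t0)) (H (u, t))).
Proof.
have evj j r : O j (H (r, t0)) -> \forall t \near t0, O j (H (r, t)).
  move=> jr; have := @tube (O j) t0 r r (cocycle_open hc _).
  have eqr x : r <= x <= r -> x = r by move=> h; apply/le_anti/andP; lra.
  have h x : r <= x <= r -> O j (H (x, t0)) by move=> /eqr ->.
  by move=> /(_ h); apply: filterS => t; apply; rewrite lexx.
set f := fun r => H (r, t0).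
elim=> {s u g} [k s u su Ok|k s v u g sv Ok h IH].
all: have Oks : O k (H (s, t0)) by apply: Ok; rewrite lexx.
  have Oku : O k (H (u, t0)) by apply: Ok; rewrite su lexx.
  exists k => // j js.
  apply: filterS2 (tube (cocycle_open hc k) Ok) (evj _ _ js) => t Tt Ojst.
  exists (c k (H (s, t)) (H (u, t))).
    exact: (hol_step (f := fun r => H (r, t))).
  have Okst : O k (H (s, t)) by apply: Tt; rewrite lexx.
  have Okut : O k (H (u, t)) by apply: Tt; rewrite lexx su.
  by rewrite (cocycle_indep hc js Ojst Oks Okst) !(cocycleM hc).
have Okv : O k (H (v, t0)) by apply: Ok; rewrite sv lexx.
have [k' Ok' {}IH] := IH; exists k' => // j js.
apply: filterS3 (tube (cocycle_open hc k) Ok) (evj _ _ js) (IH _ Okv).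
move=> t Tt Ojst [g' hg' eg'].
have Okst : O k (H (s, t)) by apply: Tt; rewrite lexx.
have Okvt : O k (H (v, t)) by apply: Tt; rewrite lexx sv.
exists (op (c k (H (s, t)) (H (v, t))) g').
  exact: (hol_cons (f := fun r => H (r, t))).
rewrite -(cocycle_opA hc) -eg' !(cocycle_opA hc).
by rewrite (cocycle_indep hc js Ojst Oks Okst) /f !(cocycleM hc).
Qed.

(** As the ends are fixed, the vertical terms of [hol_near] are local units, so the holonomy is
    locally constant in the time parameter; [interval_induction] makes this global. *)
Lemma hol_homotopy s u g t t' : t <= t' -> s <= u ->
  (forall t'', H (s, t'') = H (s, t)) -> (forall t'', H (u, t'') = H (u, t)) ->
  hol (fun r => H (r, t)) s u g -> hol (fun r => H (r, t')) s u g.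
Proof.
move=> tt' su Hs Hu.
pose Q x y := forall g, hol (fun r => H (r, x)) s u g ->
  hol (fun r => H (r, y)) s u g.
have hQ x : exists2 e, 0 < e & forall y z, x - e < y -> y < z -> z < x + e -> Q y z.
  have cHx : continuous (fun r => H (r, x)).
    apply: (continuous_comp_fun (f := fun r => (r, x))) cH.
    by apply: continuous_pair_fun;
      [exact: id_fun_continuous|exact: cst_fun_continuous].
  have [g0 hg0] := hol_exists cHx su.
  have [k Ok nk] := hol_near hg0.
  have [j Oj] := cocycle_cover hc (H (s, x)).
  have /nbhs_ballP[e /= e0 he] := nk j Oj.
  exists e => // y z xy yz zx g1.
  have B w : x - e < w < x + e -> hol (fun r => H (r, w)) s u g0.
    move=> wx; have [|g' hg'] := he w; first by rewrite /ball /= ltr_norml; lra.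
    have sw : H (s, w) = H (s, x) by rewrite !Hs.
    have uw : H (u, w) = H (u, x) by rewrite !Hu.
    rewrite sw uw (hol_idr Ok hg0) -sw => <-.
    by rewrite (@hol_idl (fun r => H (r, w)) s u)//= sw.
  have hy := B y _; have hz := B z _; move=> h1.
  by rewrite (hol_uniq h1 (hy _)); [apply: hz|]; lra.
move: g; apply: (interval_induction (P := fun x => Q x t') tt' hQ) => //.
by move=> x y _ Qxy Qy g /Qxy/Qy.
Qed.

End homotopy.

End holonomy.

(** * Calculus of paths *)

Section path_calculus.
Context {R : realType} {Y : topologicalType}.
Local Notation I := (unit_interval R).

Lemma concat_cancel (x y z w t : Y) (p : {path I from x to y})
    (e : {path I from y to z}) (q : {path I from x to z})
    (f : {path I from z to w}) (r : {path I from t to w}) :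
  path_homotopic
    (concat_path (concat_path (concat_path p e) (reverse_path q))
                 (concat_path (concat_path q f) (reverse_path r)))
    (concat_path (concat_path p (concat_path e f)) (reverse_path r)).
Proof.
apply: path_homotopic_trans (concat_pathA _ _ _) _.
apply: concat_path_homotopic (path_homotopic_refl _).
apply: path_homotopic_trans (concat_pathA _ _ _) _.
apply: path_homotopic_trans (path_homotopic_sym (concat_pathA p e f)).
apply: concat_path_homotopic (path_homotopic_refl _).
apply: path_homotopic_trans (path_homotopic_sym (concat_pathA _ _ _)) _.
apply: path_homotopic_trans (concat_constantr _).
apply: concat_path_homotopic (path_homotopic_refl _) _.
exact: concat_reversel.
Qed.

Section map_path.
Context {Z : topologicalType}.
Variables (f : Z -> Y) (cf : continuous f).

Definition map_path (x y : Z) (p : {path I from x to y}) :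
    {path I from f x to f y} :=
  mk_path (continuous_comp_fun (@cts_fun _ _ p) cf)
    (congr1 f (path_zero (s := p))) (congr1 f (path_one (s := p))).

Lemma map_path_concat x y z (p : {path I from x to y}) (q : {path I from y to z}) :
  map_path (concat_path p q) = concat_path (map_path p) (map_path q).
Proof.
apply/path_eqP => s; rewrite concat_pathE.
change (f (concat_path p q s) = if ival s <= 2^-1 then
  f (p (clamp (2 * ival s))) else f (q (clamp (2 * ival s - 1)))).
by rewrite concat_pathE; case: ifP.
Qed.

End map_path.

(** Both sides reparametrize the same map [f], and the interval is convex. *)
Lemma map_path_interval_homotopic (f : I -> Y) (cf : continuous f) (i j : I)
    (p q : {path I from i to j}) :
  path_homotopic (map_path cf p) (map_path cf q).
Proof.
apply: (@path_homotopic_reparam R Y _ _ _ _ f p q) => //;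
  by [exact: cts_fun|rewrite !path_zero|rewrite !path_one].
Qed.

End path_calculus.

Section interval_segment.
Context {R : realType}.
Local Notation I := (unit_interval R).
Variables i j : I.

Definition iseg_fun (s : I) : I := clamp ((1 - ival s) * ival i + ival s * ival j).

Lemma iseg_continuous : continuous iseg_fun.
Proof. by rewrite /iseg_fun; cts. Qed.

Lemma iseg_zero : iseg_fun zero = i.
Proof. by rewrite /iseg_fun ival0 subr0 mul1r mul0r addr0 clampK. Qed.

Lemma iseg_one : iseg_fun one = j.
Proof. by rewrite /iseg_fun ival1 subrr mul1r mul0r add0r clampK. Qed.

Definition iseg : {path I from i to j} :=
  mk_path iseg_continuous iseg_zero iseg_one.

Lemma iseg_between s : ival i <= ival j -> ival i <= ival (iseg s) <= ival j.
Proof.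
move=> ij; have := ival_ge0 s; have := ival_le1 s => s1 s0.
have -> : ival (iseg s) = (1 - ival s) * ival i + ival s * ival j.
  apply: ival_clampE; have := ival_ge0 i; have := ival_le1 j; nra.
nra.
Qed.

End interval_segment.

Section transported_class.
Context {R : realType} {Y : topologicalType} {T : Type}.
Local Notation I := (unit_interval R).
Variables (v : T -> Y) (y0 : Y) (tau : forall x, {path I from y0 to v x}).

(** Closing paths up by the chosen [tau] sends the groupoid of paths between the points [v x] to a
    single group, where classes of paths with different ends can be multiplied. *)
Definition transport x y (e : {path I from v x to v y}) : pi1 R y0 :=
  loop_class (concat_path (concat_path (tau x) e) (reverse_path (tau y))).

Lemma transport_homotopic x y (e f : {path I from v x to v y}) :
  path_homotopic e f -> transport e = transport f.
Proof.
move=> ef; apply/loop_classP/concat_path_homotopic; last exact: path_homotopic_refl.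
exact: concat_path_homotopic (path_homotopic_refl _) ef.
Qed.

Lemma transport_concat x y z (e : {path I from v x to v y})
    (f : {path I from v y to v z}) :
  transport (concat_path e f) = (transport e * transport f)%g.
Proof. by rewrite -loop_classM; apply/esym/loop_classP/concat_cancel. Qed.

Lemma transport1 x : transport (constant_path R (v x)) = 1%g.
Proof.
by apply: (mulgI (transport (constant_path R (v x)))); rewrite mulg1
  -transport_concat; apply/transport_homotopic/concat_constantl.
Qed.

Lemma transport_reverse x y (e : {path I from v x to v y}) :
  transport (reverse_path e) = (transport e)^-1%g.
Proof.
apply: (mulgI (transport e)); rewrite mulgV -transport_concat -(transport1 x).
exact/transport_homotopic/concat_reverser.
Qed.

(** Equal points [v x] and [v x'] would not suffice, as [tau] depends on the index. *)
Lemma transport_cast x x' y y' (ex : x = x') (ey : y = y')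
    (hx : v x = v x') (hy : v y = v y') (e : {path I from v x to v y}) :
  transport (cast_path hx hy e) = transport e.
Proof.
case: _ / ex in hx *; case: _ / ey in hy *.
by congr transport; apply/path_eqP.
Qed.

End transported_class.

(** * Normal covers and vanishing families *)

Section sup_family.
Context {R : realType} {I : Type}.
Implicit Types (P : set I) (h k : I -> R).

(** Adjoining 0 gives the empty index set the supremum 0. *)
Definition vsup P h : R := sup ([set 0] `|` h @` P).

Lemma vsup_has_sup P h : (forall i, h i <= 1) -> has_sup ([set 0] `|` h @` P).
Proof.
move=> h1; split; first by exists 0; left.
by exists 1 => _ [->|[i _ <-]//]; exact: ler01.
Qed.

Lemma vsup_ub P h i : (forall i, h i <= 1) -> P i -> h i <= vsup P h.
Proof.
by move=> h1 Pi; apply: sup_upper_bound; [exact: vsup_has_sup|right; exists i].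
Qed.

Lemma vsup_ge0 P h : (forall i, h i <= 1) -> 0 <= vsup P h.
Proof. by move=> h1; apply: sup_upper_bound; [exact: vsup_has_sup|left]. Qed.

Lemma vsup_le P h e : 0 <= e -> (forall i, P i -> h i <= e) -> vsup P h <= e.
Proof.
move=> e0 he; apply: ge_sup; first by exists 0; left.
by move=> _ [->//|[i Pi <-]]; exact: he.
Qed.

Lemma vsup_gt P h e : 0 <= e -> e < vsup P h -> exists2 i, P i & e < h i.
Proof.
move=> e0; apply: contraPP => hn; apply/negP; rewrite -leNgt.
by apply: vsup_le => // i Pi; rewrite leNgt; apply/negP => ehi; apply: hn; exists i.
Qed.

(** Suprema are 1-Lipschitz for the uniform distance; this is how equicontinuity survives
    regrouping. *)
Lemma vsup_dist P h k e : (forall i, h i <= 1) -> (forall i, k i <= 1) ->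
  0 <= e -> (forall i, `|h i - k i| <= e) -> `|vsup P h - vsup P k| <= e.
Proof.
move=> h1 k1 e0 hk.
have [h0 k0] := (vsup_ge0 P h1, vsup_ge0 P k1).
have A : vsup P h <= vsup P k + e.
  apply: vsup_le => [|i Pi]; first lra.
  by have := vsup_ub k1 Pi; have := hk i; rewrite ler_norml; lra.
have B : vsup P k <= vsup P h + e.
  apply: vsup_le => [|i Pi]; first lra.
  by have := vsup_ub h1 Pi; have := hk i; rewrite ler_norml; lra.
by rewrite ler_norml; lra.
Qed.

End sup_family.

Section finite_facts.

Lemma finite_argmax {R : realType} (I : choiceType) (P : set I) (h : I -> R) :
  finite_set P -> P !=set0 -> exists2 i, P i & forall j, P j -> h j <= h i.
Proof.
move=> /finite_seqP[s ->]; elim: s => [[]//|i s IH] _ /=.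
have [[j js]|s0] := pselect ([set` s] !=set0); last first.
  exists i; rewrite /= ?mem_head// => j /=; rewrite inE => /orP[/eqP->//|js].
  by exfalso; apply: s0; exists j.
have [|k ks hk] := IH; first by exists j.
have [ik|ki] := leP (h i) (h k).
  exists k; rewrite /= ?inE ?ks ?orbT// => l /=.
  by rewrite inE => /orP[/eqP->//|/hk].
exists i; rewrite /= ?mem_head// => l /=.
by rewrite inE => /orP[/eqP->//|/hk /le_trans]; apply; exact: ltW.
Qed.

Lemma finite_powerset (I : choiceType) (A : set I) :
  finite_set A -> finite_set [set F | F `<=` A].
Proof.
move=> /finite_seqP[s ->]; elim: s => [|i s IH].
  apply: sub_finite_set (finite_set1 set0) => F /= F0.
  by apply/seteqP; split=> // j /F0.
apply: (@sub_finite_set _ _ ([set F | F `<=` [set` s]] `|`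
    (fun F => i |` F) @` [set F | F `<=` [set` s]])); last first.
  by rewrite finite_setU; split=> //; exact: finite_image.
move=> F Fs; have [Fi|Fi] := pselect (F i); [right|left].
  exists (F `\ i).
    by move=> j [/Fs /=]; rewrite inE => /orP[/eqP-> /(_ erefl)|].
  by rewrite setDUK// => _ ->.
by move=> j /[dup] Fj /Fs /=; rewrite inE => /orP[/eqP ji|//]; rewrite ji in Fj.
Qed.

Lemma continuous_fsum {R : realType} {X : topologicalType} (I : choiceType)
    (D : set I) (f : I -> X -> R) : finite_set D ->
  (forall i, D i -> continuous (f i)) ->
  continuous (fun x => \sum_(i \in D) f i x).
Proof.
move=> fD cf.
rewrite (_ : (fun x => _) = (fun x => \sum_(i <- fset_set D) f i x)); last first.
  by apply/funext => x; rewrite fsbig_finite.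
have : forall i, i \in (fset_set D : seq I) -> continuous (f i).
  by move=> i; rewrite in_fset_set// => /set_mem; exact: cf.
elim: (fset_set D : seq I) => [|i s IH] cs.
  rewrite (_ : (fun x => _) = fun=> 0); first exact: cst_fun_continuous.
  by apply/funext => x; rewrite big_nil.
rewrite (_ : (fun x => _) = (fun x => f i x + \sum_(i <- s) f i x)); last first.
  by apply/funext => x; rewrite big_cons.
apply: continuousD_fun; first by apply: cs; rewrite mem_head.
by apply: IH => j js; apply: cs; rewrite inE js orbT.
Qed.

End finite_facts.

Section vanishing_families.
Context {R : realType} {X : topologicalType}.

(* Unlike partitions of unity, these families may be regrouped by taking
   suprema over sets of indices. *)
Record vanishing (I : Type) (g : I -> X -> R) : Prop := Vanishing {
  vanishing_ge0 : forall i x, 0 <= g i x;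
  vanishing_le1 : forall i x, g i x <= 1;
  vanishing_equicontinuous : forall x (e : R), 0 < e ->
    \forall y \near x, forall i, `|g i y - g i x| <= e;
  vanishing_finite : forall x (e : R), 0 < e -> finite_set [set i | e < g i x];
  vanishing_pos : forall x, exists i, 0 < g i x
}.

Lemma vanishing_continuous (I : Type) (g : I -> X -> R) i :
  vanishing g -> continuous (g i).
Proof.
move=> vg x; apply/cvgrPdist_le => e e0.
apply: filterS (vanishing_equicontinuous vg x e0) => y /(_ i).
by rewrite distrC.
Qed.

Section from_partition.
Variables (U : set (set X)) (phi : set X -> X -> R).
Hypothesis pu : partition_of_unity U phi.

Let g W x := if W \in U then phi W x else 0.

Let ge W x : U W -> g W x = phi W x. Proof. by move=> UW; rewrite /g mem_set. Qed.

(** A finite subfamily carries all but [e] of the mass at [x]; at any point, a function outside it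
    is bounded by the mass that the subfamily leaves. *)
Let partial x (e : R) : 0 < e -> exists A, [/\ finite_set A, A `<=` U,
  1 - e < \sum_(W \in A) phi W x &
  forall y W, U W -> ~ A W -> phi W y + \sum_(W \in A) phi W y <= 1].
Proof.
move=> e0; have [_ ph01 _ ph1] := pu.
have : ((1 - e)%:E < \esum_(W in U) (phi W x)%:E)%E by rewrite ph1 lte_fin; lra.
move=> /ereal_sup_gt[_ [A [fA AU] <-]]; rewrite fsumEFin// lte_fin => Ax.
exists A; split=> // y W UW AW; rewrite -lee_fin -(ph1 y).
apply: esum_ge; exists (W |` A).
  split; first by rewrite finite_setU.
  by move=> V [/= ->//|/AU].
rewrite fsbigU//=; first by rewrite fsbig_set1 EFinD fsumEFin.
by move=> V [/= ->] /AW.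
Qed.

Lemma partition_vanishing : vanishing g.
Proof.
have [cph ph01 phW ph1] := pu; split.
- by move=> W x; rewrite /g; case: ifPn => // /set_mem UW; case/andP: (ph01 W x UW).
- by move=> W x; rewrite /g; case: ifPn => // /set_mem UW; case/andP: (ph01 W x UW).
(* Mass above [1 - e / 2] at [x] stays above [1 - e] nearby, so all functions outside [A] are below
   [e] at once; inside [A] there are finitely many continuous functions. *)
- move=> x e e0; have [|A [fA AU Ax Ay]] := @partial x (e / 2); first lra.
  have cA : continuous (fun y => \sum_(W \in A) phi W y).
    by apply: continuous_fsum => // W /AU /cph.
  have n1 : \forall y \near x, 1 - e < \sum_(W \in A) phi W y.
    by apply: cvgr_gt; [exact: cA|lra].
  have n2 : \forall y \near x, forall W, A W -> `|phi W y - phi W x| <= e.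
    move: fA => /finite_fsetP[B AB].
    have := @filter_bigI _ _ B (fun W => [set y | `|phi W y - phi W x| <= e])
      (nbhs x) _.
    have h W : W \in B -> nbhs x [set y | `|phi W y - phi W x| <= e].
      move=> WB; have UW : U W by apply: AU; rewrite AB.
      have := cph _ UW x => /cvgrPdist_le /(_ e e0); apply: filterS => y.
      by rewrite distrC.
    by move=> /(_ _ h); apply: filterS => y hy W; rewrite AB => /hy.
  apply: filterS2 n1 n2 => y y1 y2 W; rewrite /g.
  case: ifPn => [/set_mem UW|]; last by rewrite subrr normr0 ltW.
  have [/y2//|AW] := pselect (A W).
  have := Ay y W UW AW; have := Ay x W UW AW.
  have := ph01 W x UW; have := ph01 W y UW.
  move=> /andP[? ?] /andP[? ?] ? ?; rewrite ler_norml; lra.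
- move=> x e e0; have [A [fA AU Ax Ay]] := @partial x e e0.
  apply: sub_finite_set fA => W /=; rewrite /g.
  case: ifPn => [/set_mem UW eW|]; last lra.
  by apply: contrapT => AW; have := Ay x W UW AW; lra.
- move=> x; apply: contrapT => hx.
  have [|A [fA AU Ax Ay]] := @partial x 1; first exact: ltr01.
  have : \sum_(W \in A) phi W x = 0.
    apply: fsbig1 => W AW; apply/le_anti; have UW := AU _ AW.
    case/andP: (ph01 W x UW) => -> _; rewrite andbT leNgt; apply/negP => W0.
    by apply: hx; exists W; rewrite ge.
  lra.
Qed.

End from_partition.

End vanishing_families.

(** * Barycentric refinement of a vanishing family *)

Section barycentric_refinement.
Context {R : realType} {X : topologicalType} {I : choiceType}.
Variable g : I -> X -> R.
Hypothesis vg : vanishing g.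

(** Only finitely many values exceed half of a given positive one, so the maximum is attained. *)
Lemma vanishing_max x : exists2 i, 0 < g i x & forall j, g j x <= g i x.
Proof.
have [i i0] := vanishing_pos vg x.
have fin : finite_set [set j | g i x / 2 < g j x].
  by apply: (vanishing_finite vg); lra.
have [|k ik hk] := finite_argmax (g ^~ x) fin; first by exists i => /=; lra.
exists k => [|j]; first by move: ik => /=; lra.
have [ij|ij] := ltP (g i x / 2) (g j x); first exact: hk.
by move: ik => /=; lra.
Qed.

(* [gap F] is positive on the open star of the barycentre of [F] in the
   barycentric subdivision of the nerve. *)
Definition gap (F : set I) (x : X) : R := Num.max 0
  (1 - vsup F (fun i => 1 - g i x) - vsup (~` F) (g ^~ x)).

Let g1 x i : g i x <= 1. Proof. exact: (vanishing_le1 vg). Qed.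
Let g01 x i : 1 - g i x <= 1.
Proof. by have := vanishing_ge0 vg i x; lra. Qed.

(** The term [1 - vsup F (fun i => 1 - g i x)] is the infimum of the values on [F], at most 1, so a
    positive gap separates the values on [F] from those outside. *)
Lemma gap_gt F x e : 0 <= e -> e < gap F x -> forall i, F i ->
  e < g i x /\ forall j, ~ F j -> g j x < g i x.
Proof.
move=> e0; rewrite /gap lt_max => /orP[|eg i Fi]; first lra.
have := vsup_ub (g01 x) Fi; have := vsup_ge0 (~` F) (g1 x) => s0 si.
split=> [|j Fj]; first lra.
by have := @vsup_ub _ _ (~` F) _ j (g1 x) Fj; lra.
Qed.

Lemma gap_pos x : exists2 F, F !=set0 & 0 < gap F x.
Proof.
have [m m0 mmax] := vanishing_max x.
(* The cut at half the maximum leaves a finite [F], whose least value is attained and lies strictly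
   above the cut. *)
pose F := [set i | g m x / 2 < g i x].
have Fm : F m by rewrite /F /=; lra.
exists F; first by exists m.
have fF : finite_set F by apply: (vanishing_finite vg); lra.
have [|k Fk hk] := finite_argmax (fun i => - g i x) fF.
  by exists m.
have A : vsup F (fun i => 1 - g i x) <= 1 - g k x.
  apply: vsup_le => [|i Fi]; first by have := vanishing_le1 vg k x; lra.
  by have := hk i Fi; lra.
have B : vsup (~` F) (g ^~ x) <= g m x / 2.
  apply: vsup_le => [|i Fi]; first lra.
  by rewrite leNgt; apply/negP.
by rewrite /gap lt_max; apply/orP; right; move: Fk; rewrite /F /=; lra.
Qed.

Lemma gap_vanishing : vanishing gap.
Proof.
split.
- by move=> F x; rewrite /gap le_max lexx.
- move=> F x; rewrite /gap ge_max ler01 /=.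
  by have := vsup_ge0 F (g01 x); have := vsup_ge0 (~` F) (g1 x); lra.
- move=> x e e0; have e2 : 0 < e / 2 by lra.
  apply: filterS (vanishing_equicontinuous vg x e2) => y hy F.
  have A : `|vsup (~` F) (g ^~ y) - vsup (~` F) (g ^~ x)| <= e / 2.
    by apply: vsup_dist => //; exact: ltW.
  have B : `|vsup F (fun i => 1 - g i y) - vsup F (fun i => 1 - g i x)| <= e / 2.
    apply: vsup_dist => // [|i]; first exact: ltW.
    by rewrite (_ : _ - _ = - (g i y - g i x)) ?normrN ?hy//; lra.
  move: A B; rewrite !ler_norml /gap /Num.max; do 2 case: ifPn; lra.
- move=> x e e0.
  (* A gap above [e] confines [F] to the finite set of indices with value above [e]. *)
  apply: sub_finite_set (finite_powerset (vanishing_finite vg x e0)) => F /= eF.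
  by move=> i /(gap_gt (ltW e0) eF)[].
- by move=> x; have [F _ F0] := gap_pos x; exists F.
Qed.

(** An index of maximal value at [x] cannot lie outside a nonempty [F] with positive gap. The empty
    set is excluded: its gap is one minus the maximum, possibly positive. *)
Lemma gap_barycentric x : exists i, forall F, F !=set0 -> 0 < gap F x -> F i.
Proof.
have [m m0 mmax] := vanishing_max x; exists m => F [i Fi] /(gap_gt (lexx 0)).
move=> /(_ i Fi)[_ hi]; apply: contrapT => /hi.
by have := mmax i; lra.
Qed.

End barycentric_refinement.

(** * Path components of the supports *)

Section path_components.
Context {R : realType} {X : topologicalType}.
Local Notation I := (unit_interval R).
Implicit Types (A : set X) (x y z : X).

Lemma range_concat x y z (p : {path I from x to y}) (q : {path I from y to z}) A :
  range p `<=` A -> range q `<=` A -> range (concat_path p q) `<=` A.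
Proof.
move=> pA qA _ [s _ <-]; rewrite concat_pathE.
by case: ifP => _; [apply: pA|apply: qA]; eexists.
Qed.

Lemma range_reverse x y (p : {path I from x to y}) A :
  range p `<=` A -> range (reverse_path p) `<=` A.
Proof. by move=> pA _ [s _ <-]; rewrite reverse_pathE; apply: pA; eexists. Qed.

Definition component A x : set X :=
  [set y | exists p : {path I from x to y}, range p `<=` A].

Lemma component_sub A x : component A x `<=` A.
Proof. by move=> y [p]; apply; exists one => //; rewrite path_one. Qed.

Lemma component_refl A x : A x -> component A x x.
Proof. by move=> Ax; exists (constant_path R x) => _ [s _ <-]. Qed.

Lemma component_sym A x y : component A x y -> component A y x.
Proof. by move=> [p pA]; exists (reverse_path p); exact: range_reverse. Qed.

Lemma component_trans A x y z :
  component A x y -> component A y z -> component A x z.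
Proof.
by move=> [p pA] [q qA]; exists (concat_path p q); exact: range_concat.
Qed.

Lemma component_eq A x y : component A x y -> component A x = component A y.
Proof.
move=> xy; apply/seteqP; split=> z; apply: component_trans => //.
exact: component_sym.
Qed.

Lemma component_path_connected A x : path_connected R (component A x).
Proof.
move=> y z xy xz; have [p pA] := component_trans (component_sym xy) xz.
(* The path must stay in the component, not only in [A]: an initial segment of [p] joins [y] to each
   of its points. *)
exists p => _ [s _ <-]; apply: component_trans xy _.
have cp : continuous p by exact: cts_fun.
exists (cast_path (path_zero (s := p)) erefl (map_path cp (iseg zero s))).
by move=> _ [t _ <-]; apply: pA; exists (iseg zero s t).
Qed.

Lemma component_open A x : locally_path_connected R X -> open A ->
  open (component A x).
Proof.
move=> lpc oA; rewrite openE => y xy.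
have : nbhs y A by apply: open_nbhs_nbhs; split=> //; exact: component_sub xy.
move=> /lpc[O [oO Oy OA pcO]]; apply: (@filterS _ _ _ O).
  move=> z Oz; apply: component_trans xy _.
  by have [p pO] := pcO _ _ Oy Oz; exists p; exact: subset_trans OA.
exact: open_nbhs_nbhs.
Qed.

Section component_family.
Context {J : Type} {D : set J}.
Variable h : J -> X -> R.
Hypotheses (vh : vanishing h) (lpc : locally_path_connected R X)
  (hD : forall x, exists2 j, D j & 0 < h j x).

Let supp j := [set y | 0 < h j y].

(** Covers are sets of sets, so the family must be indexed by the components themselves; the
    supremum merges the indices [j] that share the component [C]. *)
Definition component_sup (C : set X) (x : X) : R :=
  vsup [set j | D j /\ component (supp j) x = C] (h ^~ x).

Let h1 x j : h j x <= 1. Proof. exact: (vanishing_le1 vh). Qed.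

Lemma component_sup_gt C x e : 0 <= e -> e < component_sup C x ->
  exists j, [/\ D j, component (supp j) x = C & e < h j x].
Proof. by move=> e0 /(vsup_gt e0)[j [Dj jC] ejx]; exists j. Qed.

Lemma component_sup_vanishing : vanishing component_sup.
Proof.
split.
- by move=> C x; apply: vsup_ge0.
- by move=> C x; apply: vsup_le => //; exact: ler01.
- move=> x e e0; have e4 : 0 < e / 4 by lra.
  have [O [oO Ox Oe pcO]] := lpc (vanishing_equicontinuous vh x e4).
  (* A function above [e / 2] at [x] is positive on all of [O], so [x] and [y] have the same
     component in its support; the remaining functions are too small to matter. *)
  have eqO j y : e / 2 < h j x -> O y -> component (supp j) x = component (supp j) y.
    move=> jx Oy; apply: component_eq; have [p pO] := pcO _ _ Ox Oy.
    exists p => z /pO /Oe /(_ j); rewrite /supp /= ler_norml; lra.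
  apply: (@filterS _ _ _ O); last exact: open_nbhs_nbhs.
  move=> y Oy C; have yx j : `|h j y - h j x| <= e / 4 by exact: Oe.
  have x0 : 0 <= component_sup C x by exact: vsup_ge0.
  have y0 : 0 <= component_sup C y by exact: vsup_ge0.
  have A : component_sup C y <= component_sup C x + e.
    apply: vsup_le => [|j [Dj jC]]; first lra.
    move: (yx j); rewrite ler_norml => jyx.
    have [xe|xe] := leP (h j x) (e / 2); first lra.
    have : h j x <= component_sup C x by apply: vsup_ub; rewrite //= (eqO j y).
    lra.
  have B : component_sup C x <= component_sup C y + e.
    apply: vsup_le => [|j [Dj jC]]; first lra.
    move: (yx j); rewrite ler_norml => jyx.
    have [xe|xe] := leP (h j x) (e / 2); first lra.
    have : h j y <= component_sup C y by apply: vsup_ub; rewrite //= -(eqO j y).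
    lra.
  by rewrite ler_norml; lra.
- move=> x e e0.
  apply: (@sub_finite_set _ _
    ((fun j => component (supp j) x) @` [set j | e < h j x])).
    by move=> C /= /(component_sup_gt (ltW e0))[j [_ jC ejx]]; exists j.
  by apply: finite_image; exact: (vanishing_finite vh).
- move=> x; have [j Dj jx] := hD x; exists (component (supp j) x).
  by apply: lt_le_trans jx _; apply: vsup_ub.
Qed.

End component_family.

End path_components.

Arguments component R {X} A x.

(** * From vanishing families back to partitions of unity *)

Section to_partition.
Context {R : realType} {X : topologicalType}.
Variable g : set X -> X -> R.
Hypotheses (vg : vanishing g) (gC : forall C x, 0 < g C x -> open C /\ C x).

Let V := [set C | exists x, 0 < g C x].
Let n x := vsup setT (g ^~ x).
(** Truncation at half the supremum makes the family locally finite while keeping a positive member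
    at each point. *)
Let h (C : set X) x : R := Num.max 0 (g C x - n x / 2).

Let g1 x C : g C x <= 1. Proof. exact: (vanishing_le1 vg). Qed.

Let n_pos x : 0 < n x.
Proof.
by have [C C0] := vanishing_pos vg x; apply: lt_le_trans C0 _; apply: vsup_ub.
Qed.

Let n_near x (e : R) : 0 < e -> \forall y \near x, `|n y - n x| <= e.
Proof.
move=> e0; apply: filterS (vanishing_equicontinuous vg x e0) => y hy.
by apply: vsup_dist => //; exact: ltW.
Qed.

Let h_ge0 C x : 0 <= h C x. Proof. by rewrite /h le_max lexx. Qed.

Let h_continuous C : continuous (h C).
Proof.
move=> x; apply/cvgrPdist_le => e e0; have e2 : 0 < e / 2 by lra.
apply: filterS2 (n_near x e2) (vanishing_equicontinuous vg x e2) => y.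
move=> ny /(_ C); move: ny; rewrite !ler_norml /h /Num.max.
by do 2 case: ifPn; lra.
Qed.

Let D x := [set C | n x / 4 < g C x].

Let fD x : finite_set (D x).
Proof. by apply: (vanishing_finite vg); have := n_pos x; lra. Qed.

Let D_near x : \forall y \near x, forall C, 0 < h C y -> D x C.
Proof.
(* If [g C y] exceeds [n y / 2] and both [n] and [g C] vary by at most [n x / 12], then [g C x]
   exceeds [3 n x / 8], hence [n x / 4]. *)
have e0 : 0 < n x / 12 by have := n_pos x; lra.
apply: filterS2 (n_near x e0) (vanishing_equicontinuous vg x e0) => y.
move=> ny + C => /(_ C); move: ny.
by rewrite /D /= !ler_norml /h lt_max ltxx /=; lra.
Qed.

Let s x := \sum_(C \in [set: set X]) h C x.

Let s_D x : \forall y \near x, s y = \sum_(C \in D x) h C y.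
Proof.
apply: filterS (D_near x) => y hy; apply/esym/fsbig_widen => // C [_ /= CD].
by apply/le_anti; rewrite h_ge0 andbT leNgt; apply/negP => /hy.
Qed.

Let s_continuous : continuous s.
Proof.
move=> x; apply/cvgrPdist_le => e e0.
have cs := @continuous_fsum R X _ (D x) h (fD x) (fun C _ => @h_continuous C).
move/cvgrPdist_le: (cs x) => /(_ e e0).
by apply: filterS2 (s_D x) => y ->; rewrite (nbhs_singleton (s_D x)).
Qed.

Let s_pos x : 0 < s x.
Proof.
have [C _ hC] : exists2 C, setT C & n x / 2 < g C x.
  by apply: (vsup_gt (P := setT)); have := n_pos x; rewrite -/(n x); lra.
have CD : D x C by rewrite /D /=; have := n_pos x; lra.
have -> : s x = \sum_(C \in D x) h C x by exact: nbhs_singleton (s_D x).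
rewrite (fsbigD1 C)//=; apply: ltr_wpDr.
  by apply: fsumr_ge0.
by rewrite /h lt_max; apply/orP; right; lra.
Qed.

Let h_gt0 C x : 0 < h C x -> 0 < g C x.
Proof. by rewrite /h lt_max ltxx /=; have := n_pos x; lra. Qed.

Let h_D C x : ~ D x C -> h C x = 0.
Proof.
move=> CD; apply/le_anti; rewrite h_ge0 andbT leNgt; apply/negP => h0.
by apply: CD; exact: (nbhs_singleton (D_near x)).
Qed.

Let h_le C x : h C x <= s x.
Proof.
have [CD|/h_D ->] := pselect (D x C); last exact: ltW.
have -> : s x = \sum_(C \in D x) h C x by exact: nbhs_singleton (s_D x).
by rewrite (fsbigD1 C)//= lerDl fsumr_ge0.
Qed.

Lemma vanishing_open_cover : open_cover V.
Proof.
split=> [C [x /gC[]]//|]; apply/seteqP; split=> // x _.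
by have [C C0] := vanishing_pos vg x; exists C; [exists x|case: (gC C0)].
Qed.

Lemma vanishing_partition : exists phi : set X -> X -> R, partition_of_unity V phi.
Proof.
exists (fun C x => h C x / s x); split.
- move=> C _; apply: continuousM_fun => // x.
  by apply: cvgV; [rewrite gt_eqF|exact: s_continuous].
- move=> C x _; rewrite divr_ge0 ?h_ge0 ?(ltW (s_pos x))//=.
  by rewrite ler_pdivrMr// mul1r h_le.
- by move=> C x _; rewrite pmulr_lgt0 ?invr_gt0// => /h_gt0/gC[].
- move=> x; rewrite esum_mkcond.
  (* Both sums are extended by zero to all sets: a nonzero term has its index in [V] and in the
     finite set [D x]. *)
  have -> : (\esum_(C in [set: set X]) (if C \in V then (h C x / s x)%:E else 0) =
      \esum_(C in D x) (h C x / s x)%:E)%E.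
    rewrite [RHS]esum_mkcond; apply: eq_esum => C _.
    have [h0|h0] := eqVneq (h C x) 0; first by rewrite h0 mul0r !if_same.
    have hp : 0 < h C x by rewrite lt_def h0 h_ge0.
    have CD : D x C by exact: (nbhs_singleton (D_near x)).
    have CV : V C by exists x; exact: h_gt0.
    by rewrite !mem_set.
  rewrite esum_fset// => [|C _]; last first.
    by rewrite lee_fin divr_ge0 ?h_ge0 ?(ltW (s_pos x)).
  rewrite fsumEFin// -mulr_fsuml.
  by rewrite -(nbhs_singleton (s_D x)) divff// gt_eqF.
Qed.

End to_partition.

Section refinement.
Context {R : realType} {X : topologicalType}.

(** The elements of [V] are path components of the sets where some [gap g F] is positive, with [F] a
    nonempty set of elements of [U]; such a component lies in every element of [F]. *)
Lemma path_connected_barycentric_refinement (U : normal_cover R X) :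
  locally_path_connected R X ->
  exists V : normal_cover R X, [/\ refines V U,
    forall C, cover_sets V C -> path_connected R C &
    forall C1 C2 x, cover_sets V C1 -> cover_sets V C2 -> C1 x -> C2 x ->
      exists2 W, cover_sets U W & C1 `|` C2 `<=` W].
Proof.
move=> lpc; have [phi pu] := cover_normal U.
set g := fun W x => if W \in cover_sets U then phi W x else 0.
have vg : vanishing g by exact: partition_vanishing.
have gU W x : 0 < g W x -> cover_sets U W /\ W x.
  rewrite /g; case: ifPn => [/set_mem UW|]; last by rewrite ltxx.
  by move=> W0; split=> //; case: pu => _ _ h _; exact: h UW W0.
have vG := gap_vanishing vg.
have vC := component_sup_vanishing vG lpc (gap_pos vg).
have CP C x : 0 < component_sup (D := [set F | F !=set0]) (gap g) C x ->
  exists2 F, F !=set0 & C = component R [set y | 0 < gap g F y] x /\ 0 < gap g F x.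
  move=> /(component_sup_gt (lexx 0))[F [F0 FC Fx]].
  by exists F.
have oC C x : 0 < component_sup (D := [set F | F !=set0]) (gap g) C x ->
    open C /\ C x.
  move=> /CP[F F0 [-> Fx]]; split; last exact: component_refl.
  apply: component_open => //.
  have := open_comp (f := gap g F) (D := [set r | 0 < r]).
  apply; [by move=> y _; exact: vanishing_continuous|exact: open_gt].
have Csub C : (exists x, 0 < component_sup (D := [set F | F !=set0]) (gap g) C x) ->
    exists F x, [/\ F !=set0, C = component R [set y | 0 < gap g F y] x &
      forall i, F i -> cover_sets U i /\ C `<=` i].
  move=> [x /CP[F F0 [-> Fx]]]; exists F, x; split=> // i Fi.
  have gi y : 0 < gap g F y -> cover_sets U i /\ i y.
    by move=> /(gap_gt vg (lexx 0)) /(_ i Fi)[/gU].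
  by split=> [|y /component_sub /gi[]//]; case: (gi x Fx).
exists (NormalCover (vanishing_open_cover vC oC) (vanishing_partition vC oC)).
split=> [C /Csub[F [x [[i Fi] _ /(_ i Fi)[Ui Ci]]]]|C|C1 C2 x].
- by exists i.
- by move=> /Csub[F [x [_ -> _]]]; exact: component_path_connected.
move=> /Csub[F1 [x1 [F10 E1 H1]]] /Csub[F2 [x2 [F20 E2 H2]]] C1x C2x.
(* An element of [U] of maximal weight at the common point belongs to both index sets, so it
   contains both components. *)
have [i hi] := gap_barycentric vg x.
have [Ui Ci1] : cover_sets U i /\ C1 `<=` i.
  by apply: H1; apply: hi => //; move: C1x; rewrite E1 => /component_sub.
have [_ Ci2] : cover_sets U i /\ C2 `<=` i.
  by apply: H2; apply: hi => //; move: C2x; rewrite E2 => /component_sub.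
by exists i => // y [/Ci1|/Ci2].
Qed.

End refinement.

(** * Holonomy of paths and geometric realizations *)

Section path_holonomy.
Context {R : realType} {X : topologicalType} {S J : Type}.
Local Notation I := (unit_interval R).
Variables (op : S -> S -> S) (O : J -> set X) (c : J -> X -> X -> S).
Hypothesis hc : cocycle op O c.

Definition hol_path (p : I -> X) (g : S) : Prop :=
  hol op O c (fun r => p (clamp r)) 0 1 g.

Lemma hol_path_exists (p : I -> X) : continuous p -> exists g, hol_path p g.
Proof.
move=> cp; apply: (hol_exists hc _ ler01).
exact: continuous_comp_fun (@clamp_continuous R) cp.
Qed.

Lemma hol_path_uniq (p : I -> X) g h : hol_path p g -> hol_path p h -> g = h.
Proof. exact: (hol_uniq hc). Qed.

Lemma hol_path_concat (x y z : X) (p : {path I from x to y})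
    (q : {path I from y to z}) g h :
  hol_path p g -> hol_path q h -> hol_path (concat_path p q) (op g h).
Proof.
move=> hg hh; apply: (hol_cat hc (t := 2^-1)).
  apply: (hol_ext (f := fun r => p (clamp (2 * r + 0)))).
    move=> r r2; rewrite concat_pathE ival_clampE; last lra.
    by rewrite ifT ?addr0//; lra.
  apply: (hol_affine (f := fun r => p (clamp r))); first lra.
  have [e0 e1] : 2 * 0 + 0 = 0 :> R /\ 2 * 2^-1 + 0 = 1 :> R by split; lra.
  by rewrite e0 e1.
apply: (hol_ext (f := fun r => q (clamp (2 * r - 1)))).
  move=> r r2; rewrite concat_pathE ival_clampE; last lra.
  (* The two branches overlap only at the midpoint, where they agree. *)
  case: ifPn => // r2'; have -> : r = 2^-1 by lra.
  rewrite (clamp_le0 (r := _ - _)) ?(clamp_ge1 (r := 2 * _)) ?path_zero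
    ?path_one//; lra.
apply: (hol_affine (f := fun r => q (clamp r))); first lra.
have [e0 e1] : 2 * 2^-1 - 1 = 0 :> R /\ 2 * 1 - 1 = 1 :> R by split; lra.
by rewrite e0 e1.
Qed.

Lemma hol_path_homotopic (x y : X) (p q : {path I from x to y}) g :
  path_homotopic p q -> hol_path p g -> hol_path q g.
Proof.
move=> [H [cH H0 H1 Hx Hy]] hp.
pose K (st : R * R) := H (clamp st.1, clamp st.2).
have cK : continuous K.
  apply: (continuous_comp_fun
    (f := fun st : R * R => (clamp st.1, clamp st.2))) cH.
  by apply: continuous_pair_fun; cts.
have := @hol_homotopy _ _ _ _ op O c hc K cK 0 1 g 0 1 ler01 ler01.
rewrite /K /=.
have e0 : clamp 0 = zero :> I by apply: clamp_le0.
have e1 : clamp 1 = one :> I by apply: clamp_ge1.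
rewrite e0 e1 => h.
apply: hol_ext (h _ _ _); first by move=> r _; rewrite H1.
- by move=> t; rewrite !Hx.
- by move=> t; rewrite !Hy.
- by apply: hol_ext hp => r _; rewrite H0.
Qed.

Lemma hol_path_local (x y : X) (p : {path I from x to y}) j :
  range p `<=` O j -> hol_path p (c j x y).
Proof.
move=> pO.
have -> : c j x y = c j (p (clamp 0)) (p (clamp 1)).
  by rewrite (clamp_le0 (lexx _)) (clamp_ge1 (lexx _)) path_zero path_one.
by apply: (@hol_step _ _ _ _ op O c (fun r => p (clamp r))) => // r _;
  apply: pO; eexists.
Qed.

Lemma hol_path_reverse (x y : X) (p : {path I from x to y}) j g h :
  O j x -> hol_path p g -> hol_path (reverse_path p) h -> op g h = c j x x.
Proof.
move=> jx hg hh; apply: (@hol_path_uniq (constant_path R x)).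
  exact: hol_path_homotopic (concat_reverser p) (hol_path_concat hg hh).
by apply: hol_path_local => _ [s _ <-].
Qed.

End path_holonomy.

Section realization_facts.
Context {R : realType} {V : choiceType} (K : simplicial_complex V).
Local Notation I := (unit_interval R).
Local Notation RK := (realization R K).

Lemma open_coordinate (B : set R) u : open B -> open [set b : RK | B (b u)].
Proof.
move=> oB; rewrite weak_openE => A KA.
exists [set h : {ptws V -> R} | B (h u)] => //.
by apply: (open_comp (f := fun h : {ptws V -> R} => h u)) => // h _;
  exact: (@proj_continuous V (fun=> R) u).
Qed.

Lemma continuous_coordinate u : continuous (fun b : RK => b u).
Proof. by apply/continuousP => B; exact: open_coordinate. Qed.

Definition open_star (v : V) : set RK := [set b | 0 < b v].

Lemma open_open_star v : open (open_star v).
Proof. exact: (@open_coordinate [set r | 0 < r] v (@open_gt R 0)). Qed.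

Lemma bary_neq0 (b : RK) : exists v, 0 < b v.
Proof.
have [v bv] := simplex_neq0 (bary_simplex b).
by exists v; rewrite lt_def bv bary_ge0.
Qed.

(** The straight-line homotopy stays in one closed simplex, where continuity can be checked
    coordinatewise. *)
Lemma simplex_path_homotopic (A : set V) (b c : RK) (p q : {path I from b to c}) :
  simplices K A -> range p `<=` @closed_simplex R V K A ->
  range q `<=` @closed_simplex R V K A -> path_homotopic p q.
Proof.
move=> KA pA qA.
have pA' s : @closed_simplex R V K A (p s) by apply: pA; exists s.
have qA' s : @closed_simplex R V K A (q s) by apply: qA; exists s.
exists (fun st => segment_fun KA (pA' st.1) (qA' st.1) st.2); split=> /=.
- apply: (realization_continuous KA) => [st|u]; first exact: segment_supp.
  rewrite /= /segment_bary.
  have cp : continuous (fun st : I * I => p st.1 u).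
    have c1 : continuous (fun st : I * I => p st.1) by cts.
    exact: continuous_comp_fun c1 (@continuous_coordinate u).
  have cq : continuous (fun st : I * I => q st.1 u).
    have c1 : continuous (fun st : I * I => q st.1) by cts.
    exact: continuous_comp_fun c1 (@continuous_coordinate u).
  by cts.
- by move=> s; apply/bary_inj/funext => u /=; rewrite /segment_bary ival0; lra.
- by move=> s; apply/bary_inj/funext => u /=; rewrite /segment_bary ival1; lra.
- move=> t; apply/bary_inj/funext => u /=; rewrite /segment_bary !path_zero; lra.
- move=> t; apply/bary_inj/funext => u /=; rewrite /segment_bary !path_one; lra.
Qed.

Lemma adjacentP v w : reflect (simplices K [set v; w]) (adjacent K v w).
Proof. exact: asboolP. Qed.

Lemma range_edge v w (vw : adjacent K v w) (A : set V) : A v -> A w ->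
  range (edge R vw) `<=` @closed_simplex R V K A.
Proof.
move=> Av Aw _ [s _ <-] u.
by move=> /(segment_supp (@vertex_suppl R V K v w) (@vertex_suppr R V K v w))[->|->].
Qed.

Lemma adjacent_simplex (A : set V) v w : simplices K A -> A v -> A w ->
  adjacent K v w.
Proof.
move=> KA Av Aw; apply/adjacentP/(simplex_face KA); first by exists v; left.
by move=> _ [->|->].
Qed.

End realization_facts.

Section vertex_cocycle.
Context {R : realType} {V : choiceType} (K : simplicial_complex V).
Local Notation I := (unit_interval R).
Variables (y0 : realization R K) (tau : forall v, {path I from y0 to vertex R K v}).

(** The value 1 off the edges is a default; the cocycle identity concerns vertices of one
    simplex. *)
Definition edge_class (v w : V) : pi1 R y0 :=
  if pselect (adjacent K v w) is left vw then transport tau (edge R vw) else 1%g.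

Lemma edge_classE v w (vw : adjacent K v w) :
  edge_class v w = transport tau (edge R vw).
Proof.
rewrite /edge_class; case: pselect => // vw'.
by rewrite (bool_irrelevance vw' vw).
Qed.

Lemma edge_classM (A : set V) u v w : simplices K A -> A u -> A v -> A w ->
  (edge_class u v * edge_class v w)%g = edge_class u w.
Proof.
move=> KA Au Av Aw; rewrite (edge_classE (adjacent_simplex KA Au Av)).
rewrite (edge_classE (adjacent_simplex KA Av Aw)).
rewrite (edge_classE (adjacent_simplex KA Au Aw)) -transport_concat.
apply: transport_homotopic; apply: (simplex_path_homotopic KA).
  by apply: range_concat; exact: range_edge.
exact: range_edge.
Qed.

Lemma edge_class1 v : edge_class v v = 1%g.
Proof.
apply: (mulgI (edge_class v v)); rewrite mulg1.
exact: (edge_classM (simplex_vertex K v)).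
Qed.

End vertex_cocycle.

(** * The natural map to the shape group *)

Section subdivision_holonomy.
Context {R : realType} {X : topologicalType}.
Local Notation I := (unit_interval R).

Definition cover_member (U : normal_cover R X) : Type :=
  {W : set X | cover_sets U W}.

Lemma open_cover_member (U : normal_cover R X) (j : cover_member U) :
  open (sval j).
Proof. by case: j => W UW; apply: (cover_open U).1. Qed.

Lemma cover_member_cover (U : normal_cover R X) x :
  exists j : cover_member U, sval j x.
Proof.
have : [set: X] x by []. rewrite -(cover_open U).2 => -[W UW Wx].
by exists (exist _ W UW).
Qed.

Lemma subdivision_exists (U : normal_cover R X) (a : I -> X) :
  continuous a -> exists ts, subdivision U a ts.
Proof.
move=> ca; have cf : continuous (fun r : R => a (clamp r)).
  exact: continuous_comp_fun (@clamp_continuous R) ca.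
have [ts pts ts1] := interval_chain ler01
  (local_step (@open_cover_member U) (@cover_member_cover U) cf).
exists (map (@clamp R) ts).
have e0 : zero = clamp 0 :> I by rewrite (clamp_le0 (lexx 0)).
apply/andP; split; last by rewrite e0 last_map ts1 (clamp_ge1 (lexx 1)).
rewrite e0 path_map; apply: sub_path pts => s t /asboolP[s0 st t1 [[W UW] h]].
apply/asboolP; rewrite !ival_clampE; [|lra..].
by split=> //; exists W => // r /h; rewrite clampK.
Qed.

Section one_cover.
Variables (U : normal_cover R X) (y0 : realization R (@rips R X U)).
Variable tau : forall x, {path I from y0 to vertex R (@rips R X U) x}.

Lemma member_simplex (j : cover_member U) x y z :
  sval j x -> sval j y -> sval j z ->
  simplices (@rips R X U) [set x; y; z].
Proof.
move=> jx jy jz; split; first exact: finite_set3.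
  by exists x; left; left.
by exists (sval j); [exact: (svalP j)|move=> _ [[->|->]|->]].
Qed.

(** Three points of one element of [U] span a simplex, and the class of an edge does not depend on
    the element chosen. *)
Lemma edge_cocycle :
  cocycle *%g (fun j : cover_member U => sval j)
    (fun _ => edge_class tau).
Proof.
split=> //.
- exact: mulgA.
- exact: open_cover_member.
- exact: cover_member_cover.
- move=> j x y z jx jy jz.
  by apply: (edge_classM _ (member_simplex jx jy jz)) => /=; tauto.
Qed.

Local Notation holU := (hol_path *%g (fun j : cover_member U => sval j)
    (fun _ => edge_class tau)).

(** The class of the edge path is a holonomy of the path [a] of [X] itself; independence of the
    subdivision thus becomes uniqueness of holonomy. *)
Lemma hol_edge_path (a : I -> X) s ts
    (c : path.path (adjacent (@rips R X U)) (a s) (map a ts)) :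
  path.path (subdivision_step U a) s ts ->
  hol *%g (fun j : cover_member U => sval j) (fun _ => edge_class tau)
    (fun r => a (clamp r)) (ival s) (ival (last s ts))
    (transport tau (edge_path R c)).
Proof.
elim: ts s c => [|t ts IH] s c /=.
  move=> _; rewrite transport1.
  have [j js] := cover_member_cover U (a s).
  have := @hol_step _ _ _ _ *%g (fun j : cover_member U => sval j)
    (fun _ => edge_class tau) (fun r => a (clamp r)) j (ival s) (ival s) (lexx _).
  rewrite clampK edge_class1; apply => r rs.
  have -> : r = ival s by apply/le_anti/andP; lra.
  by rewrite clampK.
move=> /andP[/asboolP[st [W UW aW]] sts].
rewrite transport_concat -edge_classE.
have := @hol_cons _ _ _ _ *%g (fun j : cover_member U => sval j)
    (fun _ => edge_class tau) (fun r => a (clamp r)) (exist _ W UW)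
    (ival s) (ival t) (ival (last t ts)).
rewrite !clampK; apply; [exact: ltW| |exact: IH].
move=> r rst; apply: aW; rewrite ival_clampE//.
by have := ival_ge0 s; have := ival_le1 t; lra.
Qed.

Lemma hol_subdivision_loop x (a : {path I from x to x}) ts
    (h : subdivision U a ts) :
  holU a (transport tau (subdivision_loop h)).
Proof.
have /andP[p /eqP l] := h.
rewrite /subdivision_loop (@transport_cast _ _ _ _ _ _ _ _ _ _
  (path_zero (s := a)) (etrans (subdivision_last h) (path_one (s := a)))).
have := hol_edge_path (chain_adjacent (subdivision_chain h)) p.
by rewrite l ival0 ival1.
Qed.

End one_cover.

Lemma rips_connected (Xpc : path_connected R [set: X]) (U : normal_cover R X)
    x y : exists p : {path I from vertex R (@rips R X U) x
                          to vertex R (@rips R X U) y}, True.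
Proof.
have [p _] := Xpc x y Logic.I Logic.I.
have [ts h] := subdivision_exists U (@cts_fun _ _ p).
exists (cast_path (congr1 _ (path_zero (s := p)))
  (congr1 (vertex R (@rips R X U)) (etrans (subdivision_last h) (path_one (s := p))))
  (chain_path (subdivision_chain h))).
by [].
Qed.

End subdivision_holonomy.

Lemma transport_loop {R : realType} {Y : topologicalType} {T : Type}
    (v : T -> Y) x (tau : forall z, {path (unit_interval R) from v x to v z})
    (e : {path (unit_interval R) from v x to v x}) :
  transport tau e = (loop_class (tau x) * loop_class e * (loop_class (tau x))^-1)%g.
Proof. by rewrite /transport !loop_classM loop_classV. Qed.

Section natural_map.
Context {R : realType} {X : topologicalType}.
Local Notation I := (unit_interval R).
Variable x : X.
Hypothesis Xpc : path_connected R [set: X].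
Implicit Type U : normal_cover R X.

Definition rips_path U y :
    {path I from vertex R (@rips R X U) x to vertex R (@rips R X U) y} :=
  projT1 (cid (rips_connected Xpc U x y)).

Local Notation holU U := (hol_path *%g (fun j : cover_member U => sval j)
    (fun _ => edge_class (rips_path U))).

Let edgeC U := edge_cocycle (rips_path U).

Lemma rips_transport_inj U (e f : {path I from vertex R (@rips R X U) x
    to vertex R (@rips R X U) x}) :
  transport (rips_path U) e = transport (rips_path U) f ->
  loop_class e = loop_class f.
Proof. by rewrite !transport_loop => /mulIg/mulgI. Qed.

(** The natural map is well defined: both classes, up to the same conjugation, are holonomies of
    homotopic loops. *)
Lemma subdivision_loop_homotopic U (a b : {path I from x to x}) ts ts'
    (h : subdivision U a ts) (h' : subdivision U b ts') :
  path_homotopic a b ->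
  loop_class (subdivision_loop h) = loop_class (subdivision_loop h').
Proof.
move=> ab; apply: rips_transport_inj; apply: (hol_path_uniq (edgeC U)).
  apply: (hol_path_homotopic (edgeC U) ab); exact: hol_subdivision_loop.
exact: hol_subdivision_loop.
Qed.

Definition shape_image U (c : pi1 R x) : pi1 R (vertex R (@rips R X U) x) :=
  loop_class (subdivision_loop
    (projT2 (cid (subdivision_exists U (@cts_fun _ _ (loop_repr c)))))).

Lemma shape_imageE U (a : {path I from x to x}) ts (h : subdivision U a ts) :
  shape_image U (loop_class a) = loop_class (subdivision_loop h).
Proof. exact/subdivision_loop_homotopic/loop_repr_class. Qed.

(** The conjugation is there because the chosen path [rips_path U x] from the base vertex to itself
    need not be constant. *)
Lemma shape_image_hol U (a : {path I from x to x}) c :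
  holU U a c -> (loop_class (rips_path U x) * shape_image U (loop_class a)
    * (loop_class (rips_path U x))^-1)%g = c.
Proof.
move=> ac; have [ts h] := subdivision_exists U (@cts_fun _ _ a).
rewrite (shape_imageE h) -transport_loop.
by apply: (hol_path_uniq (edgeC U)) ac; exact: hol_subdivision_loop.
Qed.

Lemma shape_imageM U : {morph @shape_image U : a b / (a * b)%g}.
Proof.
move=> c d; rewrite -(loop_reprK c) -(loop_reprK d) -loop_classM.
set a := loop_repr c; set b := loop_repr d.
have [g hg] := hol_path_exists (edgeC U) (@cts_fun _ _ a).
have [k hk] := hol_path_exists (edgeC U) (@cts_fun _ _ b).
have := shape_image_hol (hol_path_concat (edgeC U) hg hk).
rewrite -(shape_image_hol hg) -(shape_image_hol hk).
by rewrite !mulgA mulgVK => /mulIg; rewrite -!mulgA => /mulgI.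
Qed.

Section refinement_map_edge_path.
Variables (V U : normal_cover R X) (VU : refines V U).

Lemma refinement_edge_path v s
    (p : path.path (adjacent (@rips R X V)) v s)
    (q : path.path (adjacent (@rips R X U)) v s) r :
  refinement_map VU (edge_path R p r) = edge_path R q r.
Proof.
elim: s v p q r => [|w s IH] v p q r; first exact/bary_inj.
rewrite /= !concat_pathE; case: ifP => _; last exact: IH.
exact/bary_inj.
Qed.

Lemma subdivision_refines (a : I -> X) ts :
  subdivision V a ts -> subdivision U a ts.
Proof.
move=> /andP[+ l]; rewrite /subdivision l andbT; apply: sub_path => s t.
move=> /asboolP[st [W VW aW]]; apply/asboolP; split=> //.
by have [W' UW' WW'] := VU VW; exists W' => // r /aW/WW'.
Qed.

Lemma shape_image_coherent c :
  pi1_refinement VU (shape_image V c) = shape_image U c.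
Proof.
rewrite -(loop_reprK c); set a := loop_repr c.
have [ts h] := subdivision_exists V (@cts_fun _ _ a).
rewrite (shape_imageE h) (shape_imageE (subdivision_refines h)).
rewrite /pi1_refinement pi1_mapE; congr loop_class; apply/path_eqP => s.
exact: refinement_edge_path.
Qed.

End refinement_map_edge_path.

Definition shape_map (c : pi1 R x) : shape_group R x :=
  ShapeGroup (fun V U VU => shape_image_coherent (U := U) VU c).

Lemma shape_mapM : {morph shape_map : a b / (a * b)%g}.
Proof. by move=> a b; apply: shape_coord_inj => U; exact: shape_imageM. Qed.

HB.instance Definition _ :=
  isMultiplicative.Build (pi1 R x) (shape_group R x) shape_map shape_mapM.

Lemma shape_map_natural : natural_to_shape shape_map.
Proof. by move=> U a ts h; exact: shape_imageE. Qed.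

(** Naturality determines all coordinates, since subdivisions exist. *)
Lemma natural_to_shape_coord (phi : pi1 R x -> shape_group R x) c U :
  natural_to_shape phi -> shape_coord (phi c) U = shape_image U c.
Proof.
move=> nphi; rewrite -(loop_reprK c).
have [ts h] := subdivision_exists U (@cts_fun _ _ (loop_repr c)).
by rewrite (shape_imageE h) (nphi _ _ _ h).
Qed.

Lemma shape_image1 U : shape_image U 1%g = 1%g.
Proof. by apply: (mulgI (shape_image U 1%g)); rewrite -shape_imageM !mulg1. Qed.

Lemma shape_imageV U c : shape_image U c^-1%g = (shape_image U c)^-1%g.
Proof.
by apply: (mulgI (shape_image U c)); rewrite -shape_imageM !mulgV shape_image1.
Qed.

(** The loop [g] stays in one element of [U], so its holonomy is the class of a degenerate edge, and
    those of [a] and its reverse cancel. *)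
Lemma shape_image_lasso U y (a : {path I from x to y}) (g : {path I from y to y})
    W : cover_sets U W -> range g `<=` W ->
  shape_image U (loop_class (concat_path (concat_path a g) (reverse_path a))) = 1%g.
Proof.
move=> UW gW; pose j : cover_member U := exist _ W UW.
have jy : sval j y by apply: gW; exists zero => //; rewrite path_zero.
have [ga ha] := hol_path_exists (edgeC U) (@cts_fun _ _ a).
have [gr hr] := hol_path_exists (edgeC U) (@cts_fun _ _ (reverse_path a)).
have hg : holU U g 1%g.
  rewrite -(edge_class1 (rips_path U) y).
  exact: (hol_path_local _ (fun _ => edge_class (rips_path U)) (j := j)).
have := hol_path_concat (edgeC U) (hol_path_concat (edgeC U) ha hg) hr.
move=> /shape_image_hol; rewrite mulg1.
have [k kx] := cover_member_cover U x.
rewrite (hol_path_reverse (edgeC U) kx ha hr) edge_class1.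
move=> /(canRL (mulgVK _)); rewrite mul1g => e.
by apply: (mulgI (loop_class (rips_path U x))); rewrite mulg1.
Qed.

End natural_map.

(** * Lasso subgroups *)

Section lasso_subgroups.
Context {R : realType} {X : topologicalType}.
Local Notation I := (unit_interval R).
Hypothesis Xpc : path_connected R [set: X].
Variable x : X.

Lemma connecting_path (y : X) : exists p : {path I from x to y}, True.
Proof.
by have [p _] := Xpc (Logic.I : [set: X] x) (Logic.I : [set: X] y); exists p.
Qed.

Definition base_path (y : X) : {path I from x to y} :=
  projT1 (cid (connecting_path y)).

Definition base_transport (y z : X) (e : {path I from y to z}) : pi1 R x :=
  transport (v := id) base_path e.

Lemma base_transport_loop (e : {path I from x to x}) : base_transport e =
  (loop_class (base_path x) * loop_class e * (loop_class (base_path x))^-1)%g.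
Proof. exact: (transport_loop (v := id)). Qed.

Lemma base_transport_conj (y z : X) (a : {path I from y to z})
    (g : {path I from z to z}) :
  base_transport (concat_path (concat_path a g) (reverse_path a)) =
  (base_transport a * base_transport g * (base_transport a)^-1)%g.
Proof. by rewrite /base_transport !transport_concat transport_reverse. Qed.

Lemma loop_class_conj1 (y : X) (s : {path I from y to x})
    (e : {path I from x to x}) :
  loop_class (concat_path (concat_path s e) (reverse_path s)) = 1%g ->
  loop_class e = 1%g.
Proof.
rewrite -loop_class1 => /loop_classP/(transport_homotopic (v := id) base_path).
rewrite -/(base_transport _) base_transport_conj (transport1 (v := id) base_path).
rewrite base_transport_loop => /(canRL (mulgVK _)); rewrite mul1g.
rewrite -{2}[base_transport s]mulg1 => /mulgI/(canRL (mulgVK _)).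
by rewrite mul1g -{2}[loop_class (base_path x)]mulg1 => /mulgI.
Qed.

Variable U : normal_cover R X.

Local Notation L := (@lasso_subgroup R X U x).

Lemma lasso_subgroup1 : L 1%g.
Proof. by move=> H [[/set_mem H1 _] _]. Qed.

Lemma lasso_subgroup_div c d : L c -> L d -> L (c * d^-1)%g.
Proof.
move=> Lc Ld H [HG HL]; apply/set_mem/HG.2; apply/mem_set; [exact: Lc|exact: Ld].
Qed.

Lemma lasso_subgroupV c : L c -> L c^-1%g.
Proof. by move=> /(lasso_subgroup_div lasso_subgroup1); rewrite mul1g. Qed.

Lemma lasso_subgroupM c d : L c -> L d -> L (c * d)%g.
Proof. by move=> Lc /lasso_subgroupV/(lasso_subgroup_div Lc); rewrite invgK. Qed.

Lemma lasso_subgroup_lasso (y : X) (a : {path I from x to y})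
    (g : {path I from y to y}) W : cover_sets U W -> range g `<=` W ->
  L (loop_class (concat_path (concat_path a g) (reverse_path a))).
Proof.
move=> UW gW; apply: sub_gen_smallest.
by exists y, a, g; split=> //; exists W.
Qed.

(** Conjugating a lasso by a loop prolongs its tail by that loop. *)
Lemma lasso_subgroup_normal c d : L c -> L (d * c * d^-1)%g.
Proof.
pose H : set (pi1 R x) := [set c | L (d * c * d^-1)%g].
suff LH : L `<=` H by exact: LH.
apply: smallest_sub.
  split; first by apply/mem_set; rewrite /H /= mulg1 mulgV; exact: lasso_subgroup1.
  move=> a b /set_mem Ha /set_mem Hb; apply/mem_set; rewrite /H /=.
  rewrite (_ : (_ * _)%g = ((d * a * d^-1) * (d * b * d^-1)^-1)%g).
    exact: lasso_subgroup_div.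
  by rewrite !invgM invgK !mulgA mulgVK.
move=> _ [y [a [g [[W UW gW] ->]]]]; rewrite /H /= -(loop_reprK d).
set p := loop_repr d.
rewrite (_ : (_ * _)%g = loop_class
  (concat_path (concat_path (concat_path p a) g) (reverse_path (concat_path p a)))).
  exact: lasso_subgroup_lasso UW gW.
rewrite -loop_classM -loop_classV -loop_classM.
(* After conjugation by the base path both sides are values of [base_transport], which is
   multiplicative on paths with arbitrary ends. *)
apply: (mulgI (loop_class (base_path x))).
apply: (mulIg (loop_class (base_path x))^-1%g).
rewrite -!base_transport_loop !base_transport_conj.
by rewrite /base_transport !transport_concat !invgM !mulgA.
Qed.

End lasso_subgroups.

Section shape_injective_to_Hausdorff.
Context {R : realType} {X : topologicalType}.
Local Notation I := (unit_interval R).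

(** An essential loop has a nontrivial coordinate at some [U], whereas the lassos of [U] have
    trivial [U]-coordinate. *)
Lemma shape_injective_lasso_Hausdorff (x0 : X) :
  path_connected R [set: X] -> shape_injective R x0 ->
  lasso_homotopically_Hausdorff R X.
Proof.
move=> Xpc [phi [nphi iphi]] y g g1.
(* Injectivity is given at [x0] only, so loops at [y] are moved there. *)
pose K (c : pi1 R y) := base_transport Xpc x0 (loop_repr c).
have KE e : K (loop_class e) = base_transport Xpc x0 e.
  exact/transport_homotopic/loop_repr_class.
have KM : {morph K : a b / (a * b)%g}.
  move=> a b; rewrite -(loop_reprK a) -(loop_reprK b) -loop_classM !KE.
  exact: transport_concat.
have [U hU] : exists U, shape_image U (K (loop_class g)) <> 1%g.
  apply: contrapT => h; apply: g1.
  have : K (loop_class g) = 1%g.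
    apply: iphi; apply: shape_coord_inj => U.
    rewrite !(natural_to_shape_coord Xpc _ _ nphi) shape_image1//.
    by apply: contrapT => hU; apply: h; exists U.
  by rewrite KE; exact: loop_class_conj1.
exists U => Lg; apply: hU.
pose N : set (pi1 R y) := [set c | shape_image U (K c) = 1%g].
suff LN : @lasso_subgroup R X U y `<=` N by exact: LN.
apply: smallest_sub.
  have K1 : K 1%g = 1%g by apply: (mulgI (K 1%g)); rewrite -KM !mulg1.
  have KV c : K c^-1%g = (K c)^-1%g.
    by apply: (mulgI (K c)); rewrite -KM !mulgV.
  split; first by apply/mem_set; rewrite /N /= K1 shape_image1.
  move=> a b /set_mem Ha /set_mem Hb; apply/mem_set; rewrite /N /=.
  by rewrite KM shape_imageM// KV shape_imageV// Ha Hb mulgV.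
move=> _ [z [a [l [[W UW lW] ->]]]]; rewrite /N /= KE base_transport_conj.
rewrite !shape_imageM// shape_imageV// (shape_image_lasso Xpc _ UW lW).
by rewrite mulg1 mulgV.
Qed.

End shape_injective_to_Hausdorff.

(** * The kernel of the natural map *)

Section kernel_of_shape_image.
Context {R : realType} {X : topologicalType}.
Local Notation I := (unit_interval R).
Hypothesis Xpc : path_connected R [set: X].
Variable x : X.
Variables U V : normal_cover R X.
Hypotheses (Vpc : forall C, cover_sets V C -> path_connected R C)
  (VU : forall C1 C2 y, cover_sets V C1 -> cover_sets V C2 -> C1 y -> C2 y ->
    exists2 W, cover_sets U W & C1 `|` C2 `<=` W).

Local Notation L := (@lasso_subgroup R X U x).
Local Notation K := (@rips R X V).
Local Notation btr := (base_transport Xpc x).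

(* Cosets are multiplied as sets, which yields only a semigroup but avoids the
   construction of a quotient group. *)
Definition lasso_coset (g : pi1 R x) : set (pi1 R x) :=
  [set k | L (g^-1 * k)%g].

Definition coset_mul (A B : set (pi1 R x)) : set (pi1 R x) :=
  [set k | exists a b, [/\ A a, B b & k = (a * b)%g]].

Lemma coset_mulA : associative coset_mul.
Proof.
move=> A B C; apply/seteqP; split=> k.
  move=> [a [_ [Aa [b [c [Bb Cc ->]]] ->]]]; rewrite mulgA.
  by exists (a * b)%g, c; split=> //; exists a, b.
move=> [_ [c [[a [b [Aa Bb ->]]] Cc ->]]]; rewrite -mulgA.
by exists a, (b * c)%g; split=> //; exists b, c.
Qed.

(** Normality of the lasso subgroup makes the product of two cosets a coset. *)
Lemma lasso_cosetM g h :
  coset_mul (lasso_coset g) (lasso_coset h) = lasso_coset (g * h)%g.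
Proof.
apply/seteqP; split=> k; rewrite /lasso_coset /=.
  move=> [a [b [/= La Lb ->]]].
  rewrite (_ : (_ * _)%g = ((h^-1 * (g^-1 * a) * h) * (h^-1 * b))%g).
    apply: lasso_subgroupM => //; rewrite -{2}[h]invgK.
    exact: (lasso_subgroup_normal Xpc).
  by rewrite invgM !mulgA mulgK.
move=> Lk; exists g, (g^-1 * k)%g; split=> /=.
- by rewrite mulVg; exact: lasso_subgroup1.
- by rewrite mulgA -invgM.
- by rewrite mulVKg.
Qed.

Lemma lasso_coset_self g : lasso_coset g g.
Proof. by rewrite /lasso_coset /= mulVg; exact: lasso_subgroup1. Qed.

Lemma lasso_coset_eq g h : L (g^-1 * h)%g -> lasso_coset g = lasso_coset h.
Proof.
move=> Lgh; apply/seteqP; split=> k; rewrite /lasso_coset /= => Lk.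
  rewrite (_ : (_ * _)%g = ((g^-1 * h)^-1 * (g^-1 * k))%g).
    by apply: lasso_subgroupM => //; exact: lasso_subgroupV.
  by rewrite invgM invgK !mulgA mulgK.
rewrite (_ : (_ * _)%g = ((g^-1 * h) * (h^-1 * k))%g).
  exact: lasso_subgroupM.
by rewrite !mulgA mulgK.
Qed.

(* When some element of [V] contains both [y] and [z] this is a single coset,
   see [path_cosetE]; otherwise it is empty. *)
Definition path_coset (y z : X) : set (pi1 R x) :=
  [set k | exists C (e : {path I from y to z}),
    [/\ cover_sets V C, range e `<=` C & lasso_coset (btr e) k]].

(** Two such paths lie in elements of [V] that meet at [z], hence in one element of [U]; the reverse
    of one followed by the other is the loop of a lasso of [U]. *)
Lemma path_cosetE (y z : X) (e : {path I from y to z}) C :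
  cover_sets V C -> range e `<=` C -> path_coset y z = lasso_coset (btr e).
Proof.
move=> VC eC; apply/seteqP; split=> k; last by exists C, e.
move=> [D [f [VD fD fk]]].
suff -> : lasso_coset (btr e) = lasso_coset (btr f) by [].
apply: lasso_coset_eq.
have Cz : C z by apply: eC; exists one => //; rewrite path_one.
have Dz : D z by apply: fD; exists one => //; rewrite path_one.
have [W UW CDW] := VU VC VD Cz Dz.
rewrite /base_transport -transport_reverse -transport_concat.
apply: (lasso_subgroup_lasso _ UW); apply: range_concat.
  by apply: range_reverse => w /eC ?; apply: CDW; left.
by move=> w /fD ?; apply: CDW; right.
Qed.

Lemma path_cosetM (A : set X) u v w : simplices K A -> A u -> A v -> A w ->
  coset_mul (path_coset u v) (path_coset v w) = path_coset u w.
Proof.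
move=> [_ _ [C VC AC]] /AC Cu /AC Cv /AC Cw.
have [e eC] := Vpc VC Cu Cv; have [f fC] := Vpc VC Cv Cw.
rewrite (path_cosetE VC eC) (path_cosetE VC fC) lasso_cosetM.
rewrite (path_cosetE VC (range_concat eC fC)).
by rewrite /base_transport transport_concat.
Qed.

Local Notation memV := (fun j : cover_member V => sval j).

(** Any vertex with positive coordinate, picked by choice; coordinates are not compared. *)
Definition nearest_vertex (b : realization R K) : X := projT1 (cid (bary_neq0 b)).

Lemma nearest_vertex_gt0 (b : realization R K) : 0 < b (nearest_vertex b).
Proof. exact: (projT2 (cid (bary_neq0 b))). Qed.

(** The chosen vertices of two points of a star need not span a simplex, but each does so with the
    centre [v]; hence the detour through [v]. *)
Definition star_coset (v : X) (b b' : realization R K) : set (pi1 R x) :=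
  coset_mul (path_coset (nearest_vertex b) v) (path_coset v (nearest_vertex b')).

Lemma star_coset_cocycle : cocycle coset_mul (@open_star R X K) star_coset.
Proof.
have gt0 (b : realization R K) v : 0 < b v -> [set u | b u != 0] v.
  by move=> ?; rewrite /= gt_eqF.
have suppM (b : realization R K) u v w : 0 < b u -> 0 < b v -> 0 < b w ->
    coset_mul (path_coset u v) (path_coset v w) = path_coset u w.
  by move=> /gt0 bu /gt0 bv /gt0 bw; exact: path_cosetM (bary_simplex b) bu bv bw.
split.
- exact: coset_mulA.
- exact: open_open_star.
- exact: bary_neq0.
- move=> v b c d bv cv dv; rewrite /star_coset.
  rewrite coset_mulA -[X in coset_mul X _]coset_mulA.
  rewrite (suppM c)//; last exact: nearest_vertex_gt0.
  rewrite (suppM b)//; exact: nearest_vertex_gt0.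
(* The edge between the two centres lies in the supports of both points, so it can be inserted at
   [b] and absorbed at [c]. *)
- move=> v w b c bv cv bw cw; rewrite /star_coset.
  rewrite -(suppM b (nearest_vertex b) w v)//; last exact: nearest_vertex_gt0.
  rewrite -coset_mulA (suppM c)//; exact: nearest_vertex_gt0.
Qed.

Local Notation holX := (hol coset_mul memV (fun _ => path_coset)).
Local Notation holK := (hol_path coset_mul (@open_star R X K) star_coset).

Lemma vertex_gt0 v u : 0 < vertex R K v u -> u = v.
Proof. by rewrite /= /vertex_fun; case: eqP => // _; rewrite ltxx. Qed.

Lemma nearest_vertex_vertex v : nearest_vertex (vertex R K v) = v.
Proof. exact/vertex_gt0/nearest_vertex_gt0. Qed.

Lemma vertex_open_star v : open_star v (vertex R K v).
Proof. by rewrite /open_star /= /vertex_fun eqxx ltr01. Qed.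

Lemma path_coset_idem v :
  coset_mul (path_coset v v) (path_coset v v) = path_coset v v.
Proof. exact: (path_cosetM (simplex_vertex K v)). Qed.

Lemma hol_constant_vertex v :
  holK (constant_path R (vertex R K v)) (path_coset v v).
Proof.
have -> : path_coset v v = star_coset v (vertex R K v) (vertex R K v).
  by rewrite /star_coset nearest_vertex_vertex path_coset_idem.
by apply: hol_path_local => _ [s _ <-]; exact: vertex_open_star.
Qed.

(** The first half of the edge lies in the star of [v] and the second in that of [w]; the vertex
    chosen at the midpoint is one of the two and cancels. *)
Lemma hol_edge v w (vw : adjacent K v w) : holK (edge R vw) (path_coset v w).
Proof.
have Kvw := adjacentP _ _ _ vw.
pose f (r : R) := edge R vw (clamp r).
have fv r : 0 <= r <= 1 -> f r v = (1 - r) + r * (v == w)%:R.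
  by move=> r01; rewrite /f /= /segment_bary /= ival_clampE// /vertex_fun eqxx mulr1.
have fw r : 0 <= r <= 1 -> f r w = (1 - r) * (w == v)%:R + r.
  by move=> r01; rewrite /f /= /segment_bary /= ival_clampE// /vertex_fun eqxx mulr1.
have f0 : f 0 = vertex R K v by rewrite /f clamp_le0// path_zero.
have f1 : f 1 = vertex R K w by rewrite /f clamp_ge1// path_one.
set m := nearest_vertex (f (1 / 2)).
have Am : [set v; w] m.
  apply: (segment_supp (@vertex_suppl R X K v w) (@vertex_suppr R X K v w)
    (t := clamp (1 / 2))).
  exact: lt0r_neq0 (nearest_vertex_gt0 (f (1 / 2))).
have h1 : hol coset_mul (@open_star R X K) star_coset f 0 (1 / 2)
    (star_coset v (f 0) (f (1 / 2))).
  apply: (@hol_step _ _ _ _ coset_mul (@open_star R X K)); first lra.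
  move=> r r2; change (0 < f r v); rewrite fv; last lra.
  by case: (v == w); rewrite ?mulr1 ?mulr0; lra.
have h2 : hol coset_mul (@open_star R X K) star_coset f (1 / 2) 1
    (star_coset w (f (1 / 2)) (f 1)).
  apply: (@hol_step _ _ _ _ coset_mul (@open_star R X K)); first lra.
  move=> r r2; change (0 < f r w); rewrite fw; last lra.
  by case: (w == v); rewrite ?mulr1 ?mulr0; lra.
have := hol_cat star_coset_cocycle h1 h2.
rewrite /star_coset f0 f1 !nearest_vertex_vertex -/m.
have Av : [set v; w] v by left. have Aw : [set v; w] w by right.
by rewrite (path_cosetM Kvw Av Av Am) (path_cosetM Kvw Am Aw Aw)
  (path_cosetM Kvw Av Am Aw).
Qed.

(** The bridge between [X] and the realization: one element [G] is the holonomy both of the path and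
    of its edge path. *)
Lemma hol_chain (a : I -> X) s ts
    (c : path.path (adjacent K) (a s) (map a ts)) :
  path.path (subdivision_step V a) s ts ->
  exists2 G, holX (fun r => a (clamp r)) (ival s) (ival (last s ts)) G &
    holK (edge_path R c) G.
Proof.
elim: ts s c => [|t ts IH] s c.
  move=> _; exists (path_coset (a s) (a s)); last exact: hol_constant_vertex.
  have [j js] := cover_member_cover V (a s).
  have := @hol_step _ _ _ _ coset_mul memV (fun _ => path_coset)
    (fun r => a (clamp r)) j (ival s) (ival s) (lexx _).
  rewrite clampK; apply => r rs.
  have -> : r = ival s by apply/le_anti/andP; lra.
  by rewrite clampK.
move=> /andP[/asboolP[st [W VW aW]] sts].
have [G hG kG] := IH t (proj2 (andP c)) sts.
exists (coset_mul (path_coset (a s) (a t)) G); last first.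
  rewrite /=; apply: (hol_path_concat star_coset_cocycle) kG; exact: hol_edge.
have := @hol_cons _ _ _ _ coset_mul memV (fun _ => path_coset)
  (fun r => a (clamp r)) (exist _ W VW) (ival s) (ival t) (ival (last t ts)).
rewrite !clampK; apply; [exact: ltW| |exact: hG].
move=> r rst; apply: aW; rewrite ival_clampE//.
by have := ival_ge0 s; have := ival_le1 t; lra.
Qed.

(** In [X] the holonomy with values in cosets is the coset of the class of the path, as follows by
    concatenating its pieces. *)
Lemma hol_path_class (a : I -> X) (ca : continuous a) s t G :
  holX (fun r => a (clamp r)) s t G -> forall i j, ival i = s -> ival j = t ->
  G = lasso_coset (btr (map_path ca (iseg i j))).
Proof.
have seg (k : cover_member V) i j : ival i <= ival j ->
    (forall r, ival i <= r <= ival j -> sval k (a (clamp r))) ->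
    path_coset (a i) (a j) = lasso_coset (btr (map_path ca (iseg i j))).
  move=> ij hk; apply: (path_cosetE (svalP k)) => _ [r _ <-].
  rewrite -[X in _ X]/(a (iseg i j r)) -(clampK (iseg i j r)).
  exact/hk/iseg_between.
elim=> {s t G} [k s t st hk|k s t u G st hk h IH] i j ei ej.
  by rewrite -ei -ej !clampK in hk *; apply: (seg k) => //; rewrite ei ej.
have et : ival (clamp t) = t.
  apply: ival_clampE; have := hol_le h; have := ival_ge0 i; have := ival_le1 j.
  lra.
rewrite (IH _ _ et ej) -ei clampK (seg k); last first.
- by move=> r; rewrite ei et; exact: hk.
- by rewrite ei et.
rewrite lasso_cosetM; congr lasso_coset.
rewrite /base_transport -transport_concat; apply: transport_homotopic.
by rewrite -map_path_concat; exact: map_path_interval_homotopic.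
Qed.

(** A null-homotopic edge loop has the holonomy of a constant path, the trivial coset; but that
    holonomy is also the coset of the loop in [X]. *)
Lemma shape_image_ker_lasso c : shape_image V c = 1%g -> L c.
Proof.
rewrite -(loop_reprK c); set a := loop_repr c.
have [ts h] := subdivision_exists V (@cts_fun _ _ a).
rewrite (shape_imageE Xpc h) -loop_class1 => /loop_classP hom.
have /andP[p /eqP l] := h.
have [G hG kG] := hol_chain (chain_adjacent (subdivision_chain h)) p.
have GE : G = path_coset x x.
  apply: (hol_path_uniq star_coset_cocycle) (hol_constant_vertex x).
  exact: (hol_path_homotopic star_coset_cocycle hom).
have xx : path_coset x x = lasso_coset 1%g.
  have [j jx] := cover_member_cover V x.
  rewrite (@path_cosetE _ _ (constant_path R x) _ (svalP j)).
    by rewrite /base_transport (transport1 (v := id)).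
  by move=> _ [s _ <-].
have Ga : G = lasso_coset (btr a).
  rewrite (hol_path_class (@cts_fun _ _ a) hG erefl (congr1 (@ival R) (esym l))).
  congr lasso_coset; rewrite /base_transport.
  (* The path produced by [map_path] runs from [a zero] to [a one], which equal [x] only
     propositionally. *)
  rewrite -(@transport_cast _ _ _ _ _ _ _ _ _ _ (path_zero (s := a))
    (path_one (s := a)) (path_zero (s := a)) (path_one (s := a))).
  apply: transport_homotopic.
  apply: (@path_homotopic_reparam _ _ _ _ _ _ a (iseg zero one) id) => //.
  - exact: cts_fun.
  - exact: cts_fun.
  - exact: id_fun_continuous.
  - by rewrite path_zero.
  - by rewrite path_one.
have : lasso_coset 1%g (btr a) by rewrite -xx -GE Ga; exact: lasso_coset_self.
rewrite /lasso_coset /= invg1 mul1g base_transport_loop.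
(* What has been shown to be in the lasso subgroup is a conjugate of the class; normality undoes the
   conjugation. *)
set t := loop_class (base_path Xpc x x) => La.
have := lasso_subgroup_normal Xpc t^-1%g La.
by rewrite invgK !mulgA mulVg mul1g mulgVK.
Qed.

End kernel_of_shape_image.

Section Hausdorff_to_shape_injective.
Context {R : realType} {X : topologicalType}.

(** If two classes have the same image, their quotient has trivial coordinate at a suitable
    refinement of each [U], so it lies in every lasso subgroup. *)
Lemma lasso_Hausdorff_shape_injective (x : X) :
  path_connected R [set: X] -> locally_path_connected R X ->
  lasso_homotopically_Hausdorff R X -> shape_injective R x.
Proof.
move=> Xpc Xlpc lhH.
exists [the {multiplicative pi1 R x -> shape_group R x} of shape_map Xpc (x := x)].
split; first exact: shape_map_natural.
move=> c d /= cd; apply: contrapT => cNd.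
have [U hU] : exists U : normal_cover R X, ~ @lasso_subgroup R X U x (c * d^-1)%g.
  have := lhH x (loop_repr (c * d^-1)%g); rewrite loop_reprK; apply.
  by move=> /(canRL (mulgVK _)); rewrite mul1g.
apply: hU; have [V [_ Vpc VU]] := path_connected_barycentric_refinement U Xlpc.
apply: (shape_image_ker_lasso Xpc Vpc VU).
rewrite shape_imageM// shape_imageV//.
have -> : shape_image V c = shape_image V d.
  exact: (congr1 (fun h => shape_coord h V) cd).
exact: mulgV.
Qed.

End Hausdorff_to_shape_injective.

Theorem theorem3p7 (R : realType) (X : topologicalType) (x0 : X)
    (Xpc : path_connected R [set: X])
    (Xlpc : locally_path_connected R X) :
  lasso_homotopically_Hausdorff R X <-> shape_injective R x0.
Proof.
split; first exact: lasso_Hausdorff_shape_injective.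
exact: shape_injective_lasso_Hausdorff.
Qed.
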